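(* Let $X_0$ and $X_\varepsilon$ ($\varepsilon>0$) be real Hilbert spaces, let $L_\varepsilon\colon X_\varepsilon\to X_0$ ($\varepsilon>0$) be bounded linear operators, and suppose that $X_\varepsilon$ Mosco-converge to $X_0$ along $L_\varepsilon$. Let $\mathcal{E}_\varepsilon\colon X_\varepsilon\to[0,\infty]$ ($\varepsilon>0$) and $\mathcal{E}_0\colon X_0\to[0,\infty]$ be convex and lower semicontinuous, and let $S_\varepsilon$, $S_0$ be the gradient flows of $\mathcal{E}_\varepsilon$, $\mathcal{E}_0$ respectively. If $\mathcal{E}_\varepsilon$ Mosco-converge to $\mathcal{E}_0$ along $L_\varepsilon$, then $S_\varepsilon$ uniformly converge to $S_0$ along $L_\varepsilon$.
   Context: All limits are as $\varepsilon\to0^+$; $\rightharpoonup$ is weak convergence. Strong convergence along $L_\varepsilon$: for $w\in X_0$, $w^\varepsilon\in X_\varepsilon$, we say $w^\varepsilon$ converge strongly to $w$ along $L_\varepsilon$ if $\|w^\varepsilon\|_{X_\varepsilon}\to\|w\|_{X_0}$ and $L_\varepsilon w^\varepsilon\to w$ in $X_0$. Mosco convergence of spaces: $X_\varepsilon$ Mosco-converge to $X_0$ along $L_\varepsilon$ if (i) $\limsup_{\varepsilon\to0^+}\|L_\varepsilon\|_{B(X_\varepsilon,X_0)}\le1$, and (ii) for every $w\in X_0$ there exists $(w^\varepsilon)$, $w^\varepsilon\in X_\varepsilon$, such that $L_\varepsilon w^\varepsilon\rightharpoonup w$ in $X_0$. Mosco convergence of functionals: $\mathcal{E}_\varepsilon$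 Mosco-converge to $\mathcal{E}_0$ along $L_\varepsilon$ if (i) whenever $w^\varepsilon\in X_\varepsilon$, $w\in X_0$, $\limsup_{\varepsilon\to0^+}\|w^\varepsilon\|_{X_\varepsilon}<\infty$ and $L_\varepsilon w^\varepsilon\rightharpoonup w$ in $X_0$, then $\liminf_{\varepsilon\to0^+}\mathcal{E}_\varepsilon(w^\varepsilon)\ge\mathcal{E}_0(w)$; and (ii) for every $w\in D(\mathcal{E}_0)$ there exists $(w^\varepsilon)$, $w^\varepsilon\in X_\varepsilon$, with $L_\varepsilon w^\varepsilon\to w$ in $X_0$, $\|w^\varepsilon\|_{X_\varepsilon}\to\|w\|_{X_0}$ and $\mathcal{E}_\varepsilon(w^\varepsilon)\to\mathcal{E}_0(w)$. Here $D(\mathcal{E})=\{\mathcal{E}<\infty\}$. Gradient flow: for a convex, lower semicontinuous $\mathcal{E}\colon X\to[0,\infty]$ on a Hilbert space $X$, for every $u_0\in\overline{D(\mathcal{E})}$ and $T>0$ there is exactly one $u\in C([0,T],X)\cap W^{1,1}_{loc}(]0,T],X)$ with $u_t\in-\partial\mathcal{E}(u)$ for a.e. $t\in]0,T[$ and $u(0)=u_0$; the map $S\colon u_0\mapsto u$ is the gradient flow of $\mathcal{E}$ ($\partial$ is the convex subdifferential). Uniform convergence of flows: $S_\varepsilon$ uniformly converge to $S_0$ along $L_\varepsilon$ if (for every $T>0$) $L_\varepsilon S_\varepsilon u_0^\varepsilon\to S_0u_0$ in $C([0,T],X_0)$ and $\|S_\varepsilon u_0^\varepsilon\|_{X_\varepsilon}\to\|S_0u_0\|_{X_0}$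 in $C([0,T])$ whenever $u_0\in\overline{D(\mathcal{E}_0)}$, $u_0^\varepsilon\in\overline{D(\mathcal{E}_\varepsilon)}$ and $u_0^\varepsilon$ converge strongly to $u_0$ along $L_\varepsilon$.
   Formalization: In the Mosco convergence of functionals, the lower bound (i) is required along every sequence ε_k→0+ with w_k in X_{ε_k}, not only for families w^ε defined for all ε>0; with only full families the theorem is false. *)

(* Defs.v *)
From HB Require Import structures.
From mathcomp Require Import all_boot all_order all_algebra.
From mathcomp Require Import all_classical all_reals all_analysis.

Set Implicit Arguments.
Unset Strict Implicit.
Unset Printing Implicit Defensive.

Import Order.TTheory GRing.Theory Num.Theory.
Import numFieldNormedType.Exports.

Local Open Scope classical_set_scope.
Local Open Scope ring_scope.

(* Real Hilbert spaces: the norm, hence the topology, is the library's, and the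
   inner product is required to induce it. *)
HB.mixin Record CompleteNormedModule_isHilbert (R : realType) V
    of CompleteNormedModule R V := {
  inner : V -> V -> R ;
  innerC : forall x y : V, inner x y = inner y x ;
  inner_linearl : forall (a : R) (x y z : V),
    inner (a *: x + y) z = a * inner x z + inner y z ;
  inner_norm : forall x : V, inner x x = `|x| ^+ 2
}.

#[short(type="hilbertType")]
HB.structure Definition Hilbert (R : realType) :=
  {V of CompleteNormedModule R V & CompleteNormedModule_isHilbert R V}.

Section functionals.
Context {R : realType} {X : hilbertType R}.
Implicit Types (E : X -> \bar R) (x y v : X).

Definition dom E : set X := [set x | (E x < +oo)%E].

Definition convex_functional E : Prop := forall (t : R) x y, 0 <= t <= 1 ->
  (E (t *: x + (1 - t) *: y)%R <= t%:E * E x + (1 - t)%:E * E y)%E.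

Definition convex_lsc E : Prop :=
  [/\ forall x, (0 <= E x)%E, convex_functional E & lower_semicontinuous E].

Definition subdifferential E x : set X :=
  [set v | dom E x /\ forall y, (E x + (inner v (y - x))%:E <= E y)%E].

Definition weak_cvg {T : Type} (F : set_system T) (f : T -> X) x : Prop :=
  forall y, inner (f t) y @[t --> F] --> inner x y.

End functionals.

Definition opnorm {R : realType} {X Y : hilbertType R} (L : X -> Y) : \bar R :=
  ereal_sup [set (`|L x|)%:E | x in [set x : X | `|x| <= 1]].

(* Bochner integral over D for Lebesgue measure, by approximation in L^1 norm by
   vector-valued simple functions. *)
Section bochner.
Context {R : realType} {X : hilbertType R}.
Local Notation mu := (@lebesgue_measure R).

Record simple_function := SimpleFunction {
  sf_size : nat ;
  sf_set : 'I_sf_size -> set R ;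
  sf_val : 'I_sf_size -> X ;
  sf_measurable : forall i, measurable (sf_set i) ;
  sf_finite : forall i, (mu (sf_set i) < +oo)%E
}.

Definition sf_eval (s : simple_function) (t : R) : X :=
  \sum_(i < sf_size s) \1_(sf_set i) t *: sf_val i.

Definition sf_integral (D : set R) (s : simple_function) : X :=
  \sum_(i < sf_size s) fine (mu (sf_set i `&` D)) *: sf_val i.

Definition has_bochner_integral (D : set R) (f : R -> X) (v : X) : Prop :=
  exists s : nat -> simple_function,
    [/\ forall n, measurable_fun D (fun t => `|f t - sf_eval (s n) t|),
        (\int[mu]_(t in D) (`|f t - sf_eval (s n) t|)%:E)%E @[n --> \oo]
          --> (0 : \bar R)
      & sf_integral D (s n) @[n --> \oo] --> v].

Definition bochner_integrable (D : set R) (f : R -> X) : Prop :=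
  exists v, has_bochner_integral D f v.

(* L^1_loc(]0, T], X): integrability up to T, but only away from 0. *)
Definition L1loc (T : R) (f : R -> X) : Prop :=
  forall d, 0 < d < T -> bochner_integrable `[d, T] f.

(* C^1 functions with compact support in ]0, T[ *)
Definition test_function (T : R) (phi : R -> R) : Prop :=
  [/\ forall t, derivable phi t 1, continuous (derive1 phi)
    & exists a b : R, [/\ 0 < a, b < T & forall t, phi t != 0 -> a <= t <= b]].

Definition weak_derivative (T : R) (u g : R -> X) : Prop :=
  forall phi, test_function T phi -> exists2 v : X,
    has_bochner_integral `]0, T[ (fun t => derive1 phi t *: u t) v
  & has_bochner_integral `]0, T[ (fun t => phi t *: g t) (- v).

(* u is in W^{1,1}_loc(]0, T], X) and its derivative is g *)
Definition W11loc (T : R) (u g : R -> X) : Prop :=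
  [/\ L1loc T u, L1loc T g & weak_derivative T u g].

Definition flow_solution (E : X -> \bar R) (T : R) (u0 : X) (u : R -> X) :=
  [/\ {within `[0, T], continuous u}, u 0 = u0
    & exists2 u_t : R -> X, W11loc T u u_t
      & {ae mu, forall t : R, t \in `]0, T[ ->
                  subdifferential E (u t) (- u_t t)}].

(* Solutions are unique, so those on the intervals [0, T] are the restrictions
   of one curve S u0, of which only the values at times t >= 0 matter. *)
Definition gradient_flow (E : X -> \bar R) (S : X -> R -> X) : Prop :=
  forall u0, closure (dom E) u0 -> forall T, 0 < T -> flow_solution E T u0 (S u0).

End bochner.

(* Families indexed by eps > 0 are indexed here by all of R; the filter 0^'+ and
   the explicit guards 0 < eps discard the other indices. *)
Section mosco.
Context {R : realType} (X0 : hilbertType R) (X : R -> hilbertType R)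
  (L : forall eps, X eps -> X0).

Definition strong_cvg (w : forall eps, X eps) (w0 : X0) : Prop :=
  (`|w eps| @[eps --> 0^'+] --> `|w0|) /\
  (L (w eps) @[eps --> 0^'+] --> w0).

Definition mosco_spaces : Prop :=
  (limf_esup (fun eps : R => opnorm (@L eps)) 0^'+ <= 1)%E /\
  (forall w0 : X0, exists w : forall eps, X eps,
     weak_cvg 0^'+ (fun eps => L (w eps)) w0).

(* In the lower bound, eps -> 0+ is read, as is usual for Gamma-convergence with
   a continuous parameter, along arbitrary sequences eps_k -> 0+.  Testing only
   families defined for all eps > 0 would say nothing about weak limits along a
   sequence that no bounded full family attains. *)
Definition mosco_functionals (E : forall eps, X eps -> \bar R)
    (E0 : X0 -> \bar R) : Prop :=
  (forall (eps : nat -> R) (w : forall k, X (eps k)) (w0 : X0),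
     (forall k, 0 < eps k) -> eps k @[k --> \oo] --> (0 : R) ->
     (limn_esup (fun k => (`|w k|)%:E) < +oo)%E ->
     weak_cvg \oo (fun k => L (w k)) w0 ->
     (E0 w0 <= limn_einf (fun k => E (eps k) (w k)))%E) /\
  (forall w0 : X0, dom E0 w0 -> exists w : forall eps, X eps,
     strong_cvg w w0 /\ (E eps (w eps) @[eps --> 0^'+] --> E0 w0)).

Definition uniform_cvg_flows (E : forall eps, X eps -> \bar R)
    (E0 : X0 -> \bar R) (S : forall eps, X eps -> R -> X eps)
    (S0 : X0 -> R -> X0) : Prop :=
  forall T : R, 0 < T -> forall (u : forall eps, X eps) (u0 : X0),
    closure (dom E0) u0 ->
    (forall eps, 0 < eps -> closure (dom (E eps)) (u eps)) ->
    strong_cvg u u0 ->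
    {uniform `[0, T], (fun eps t => L (S eps (u eps) t)) @ 0^'+ --> S0 u0} /\
    {uniform `[0, T], (fun eps t => `|S eps (u eps) t|) @ 0^'+
                        --> (fun t => `|S0 u0 t|)}.

End mosco.

(* Main.v *)
Require Import Defs.
From HB Require Import structures.
From mathcomp Require Import all_boot all_order all_algebra.
From mathcomp Require Import all_classical all_reals all_analysis.
From mathcomp Require Import measurable_realfun ring lra.
Import Order.TTheory GRing.Theory Num.Theory.
Import numFieldNormedType.Exports.
Local Open Scope classical_set_scope.
Local Open Scope ring_scope.

(** The gradient flow of a convex functional is approximated by the implicit Euler
    scheme with an error that depends only on the functional's value at the initial
    point of the scheme. If [u] is a flow started at [u0], [p] has finite energy
    and [P k] are the iterates with mesh [l] started at [p], then
    [`|u t - P k| ^+ 2 <= 3 * (`|u0 - p| ^+ 2 + 2 * l * E p)] for [t] in the [k]-th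
    mesh interval ([implicit_euler_error]). This bound holds with the same mesh for
    all [E eps] and for [E0]. Since the energies [E eps (z eps)] of a recovery
    sequence [z] of [p] converge, choosing [p] close to [u0] and then [l] small
    makes the error small uniformly in time and in small [eps]; what remains is the
    convergence of finitely many resolvents ([flows_uniform_cvg]).

    Resolvents converge strongly ([resolvent_strong_cvg]): along a sequence of
    parameters their images have a weak limit ([bounded_weak_subsequence]), the
    lower bound of Mosco convergence and the variational inequality of the resolvent
    leave no room between the resolvents and a recovery sequence, and the inner
    products that occur converge because strong convergence along [L] pairs with
    weak convergence ([cvg_inner_strong]); there the bound on the norms of the
    operators [L] is used.

    The error bound rests on the growth of the squared distance between the flow and
    a segment ([energy_estimate_closed]), that is, on the chain rule for
    [`|u t| ^+ 2]. It is derived directly from the weak formulation: testing with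
    cutoff functions gives the increments of [u] up to the [L^1] distance from the
    derivative to a simple function ([weak_derivative_increment]), and adding the
    increments of the squared norm over short intervals gives the estimate
    without a pointwise derivative of [u]. *)

(** * Inner products and uniformly convex minimization *)

Section inner_product.
Context {R : realType} {X : hilbertType R}.
Implicit Types (x y z : X) (a : R).

Lemma innerDl x y z : inner (x + y) z = inner x z + inner y z.
Proof. by have := inner_linearl 1 x y z; rewrite scale1r mul1r. Qed.

Lemma innerDr x y z : inner z (x + y) = inner z x + inner z y.
Proof. by rewrite innerC innerDl !(innerC _ z). Qed.

Lemma inner0l x : inner 0 x = 0.
Proof. by apply: (addrI (inner 0 x)); rewrite -innerDl !addr0. Qed.

Lemma innerZl a x y : inner (a *: x) y = a * inner x y.
Proof. by have := inner_linearl a x 0 y; rewrite addr0 inner0l addr0. Qed.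

Lemma innerZr a x y : inner y (a *: x) = a * inner y x.
Proof. by rewrite innerC innerZl innerC. Qed.

Lemma innerNl x y : inner (- x) y = - inner x y.
Proof. by rewrite -scaleN1r innerZl mulN1r. Qed.

Lemma innerNr x y : inner y (- x) = - inner y x.
Proof. by rewrite innerC innerNl innerC. Qed.

Lemma innerBl x y z : inner (x - y) z = inner x z - inner y z.
Proof. by rewrite innerDl innerNl. Qed.

Definition innerE := (innerDl, innerDr, innerNl, innerNr, innerZl, innerZr).

Lemma inner_suml (n : nat) (f : 'I_n -> X) y :
  inner (\sum_(i < n) f i) y = \sum_(i < n) inner (f i) y.
Proof.
by elim/big_ind2: _ => [|a x b z <- <-|//]; rewrite ?inner0l ?innerDl.
Qed.

Lemma normD2 x y : `|x + y| ^+ 2 = `|x| ^+ 2 + 2 * inner x y + `|y| ^+ 2.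
Proof. by rewrite -!inner_norm !innerE (innerC y x); ring. Qed.

Lemma normB2 x y : `|x - y| ^+ 2 = `|x| ^+ 2 - 2 * inner x y + `|y| ^+ 2.
Proof. by rewrite normD2 innerNr normrN; ring. Qed.

(** A quadratic polynomial that stays nonnegative has nonpositive
    discriminant. *)
Lemma quadratic_discriminant (p q r : R) : 0 <= r ->
  (forall t, 0 <= p + 2 * t * q + t ^+ 2 * r) -> q ^+ 2 <= p * r.
Proof.
rewrite le_eqVlt => /predU1P[<-|r0] pos.
  have [->|q0] := eqVneq q 0; first by rewrite expr0n /= mulr0.
  have := pos (- (p + 1) / (2 * q)).
  have -> : p + 2 * (- (p + 1) / (2 * q)) * q + (- (p + 1) / (2 * q)) ^+ 2 * 0
            = - 1 by field.
  by rewrite lerNr oppr0 ler10.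
have := pos (- q / r).
have -> : p + 2 * (- q / r) * q + (- q / r) ^+ 2 * r = (p * r - q ^+ 2) / r.
  by field; rewrite gt_eqF.
by rewrite pmulr_lge0 ?invr_gt0 // subr_ge0.
Qed.

Lemma cauchy_schwarz x y : `|inner x y| <= `|x| * `|y|.
Proof.
rewrite -ler_sqr ?nnegrE ?mulr_ge0 // real_normK ?num_real // exprMn.
apply: quadratic_discriminant => [|t]; first exact: sqr_ge0.
suff <- : `|x + t *: y| ^+ 2 = `|x| ^+ 2 + 2 * t * inner x y + t ^+ 2 * `|y| ^+ 2.
  exact: sqr_ge0.
by rewrite normD2 innerZr normrZ exprMn real_normK ?num_real //; ring.
Qed.

Lemma inner_le x y : inner x y <= `|x| * `|y|.
Proof. exact: le_trans (ler_norm _) (cauchy_schwarz x y). Qed.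

Lemma cvg_inner {T : Type} (F : set_system T) {FF : Filter F} (f g : T -> X) x y :
  f @ F --> x -> g @ F --> y -> inner (f t) (g t) @[t --> F] --> inner x y.
Proof.
move=> fx gy.
have polar (u v : X) : inner u v = (`|u + v| ^+ 2 - `|u - v| ^+ 2) / 4.
  by rewrite normD2 normB2; field.
rewrite polar; under eq_fun do rewrite polar.
apply: cvgM; last exact: cvg_cst.
rewrite !expr2.
apply: cvgB; apply: cvgM; apply: cvg_norm; (exact: cvgD || exact: cvgB).
Qed.

(** A minimizing sequence of a function that is uniformly convex at midpoints is
    a Cauchy sequence, and lower semicontinuity makes its limit a minimizer. *)
Lemma minimizer_exists (F : X -> \bar R) (k : R) : 0 < k ->
  (forall x, 0 <= F x)%E -> lower_semicontinuous F -> (exists x, F x < +oo)%E ->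
  (forall x y, F (2^-1 *: (x + y)) + (k * `|x - y| ^+ 2)%:E
     <= (2^-1)%:E * (F x + F y))%E ->
  exists v, forall y, (F v <= F y)%E.
Proof.
move=> k0 F0 lscF [x0 Fx0] midF.
have lbF : (0 <= ereal_inf (range F))%E.
  by apply: le_ereal_inf_tmp => _ [x _ <-].
have mfin : ereal_inf (range F) \is a fin_num.
  rewrite ge0_fin_numE //; apply: le_lt_trans Fx0.
  by apply: ereal_inf_lbound; exists x0.
set m := fine (ereal_inf (range F)).
have mE : ereal_inf (range F) = m%:E by rewrite fineK.
have mle x : (m%:E <= F x)%E by rewrite -mE; apply: ereal_inf_lbound; exists x.
have /choice[x xP] (n : nat) : exists x, (F x < (m + n.+1%:R^-1)%:E)%E.
  have : (ereal_inf (range F) < (m + n.+1%:R^-1)%:E)%E.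
    by rewrite mE lte_fin ltrDl invr_gt0.
  by move=> /ereal_inf_lt[_ [z _ <-] zm]; exists z.
have dist i j n : (n <= i)%N -> (n <= j)%N ->
    k * `|x i - x j| ^+ 2 <= n.+1%:R^-1.
  move=> ni nj.
  have le_inv l : (n <= l)%N -> l.+1%:R^-1 <= n.+1%:R^-1 :> R.
    by move=> nl; rewrite lef_pV2 ?posrE // ler_nat.
  have := midF (x i) (x j).
  have Fi := ltW (xP i); have Fj := ltW (xP j); have li := le_inv _ ni.
  have lj := le_inv _ nj.
  have mm := mle (2^-1 *: (x i + x j)).
  move=> mid; rewrite -lee_fin.
  have : ((m + k * `|x i - x j| ^+ 2)%:E <= (m + n.+1%:R^-1)%:E)%E.
    rewrite EFinD; apply: (le_trans (leeD mm (lexx _))).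
    apply: (le_trans mid).
    have le2 : (F (x i) + F (x j) <= (m + i.+1%:R^-1)%:E + (m + j.+1%:R^-1)%:E)%E.
      exact: leeD.
    apply: (le_trans (lee_wpmul2l _ le2)); first by rewrite lee_fin invr_ge0.
    rewrite -EFinD -EFinM lee_fin; move: li lj.
    by move: (i.+1%:R^-1) (j.+1%:R^-1) (n.+1%:R^-1) => pi pj pn; lra.
  by rewrite !lee_fin lerD2l.
have xcvg : cvgn x.
  apply: cauchy_cvg; apply/cauchy_exP => e e0.
  have [n n_lt] : exists n : nat, n.+1%:R^-1 < k * e ^+ 2.
    have [n _ H] := near_infty_natSinv_lt (PosNum (mulr_gt0 k0 (exprn_gt0 2 e0))).
    by exists n; apply: H => /=.
  exists (x n); exists n => // j /= nj; rewrite /ball_.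
  rewrite -ball_normE /ball_ /= -ltr_sqr ?nnegrE ?(ltW e0) // -(ltr_pM2l k0).
  exact: le_lt_trans (dist _ _ _ (leqnn n) nj) n_lt.
exists (lim (x @ \oo)) => y; apply: le_trans (mle y).
apply/lee_addgt0Pr => e e0; rewrite leNgt; apply/negP => /lscF[V Vn Vgt].
have [N _ NP] : \forall n \near \oo, V (x n) by exact: xcvg.
have [n0 _ H] := near_infty_natSinv_lt (PosNum e0).
have := Vgt _ (NP (maxn N n0) (leq_maxl _ _)).
apply/negP; rewrite -leNgt; apply: (le_trans (ltW (xP _))).
by rewrite lee_fin lerD2l ltW //; apply: H; rewrite /= leq_maxr.
Qed.

End inner_product.

(** * Weak sequential compactness of bounded sequences *)

Section weak_compactness.
Context {R : realType} {X : hilbertType R}.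
Implicit Types (x y : X) (w : nat -> X) (M d : R).

(** Riesz representation: the representing vector minimizes
    [`|y| ^+ 2 - 2 * l y], and the first variation there is the identity. *)
Lemma riesz_representation (l : X -> R) M :
  (forall a x y, l (a *: x + y) = a * l x + l y) ->
  (forall x, `|l x| <= M * `|x|) ->
  exists v, forall x, l x = inner v x.
Proof.
move=> llin lM.
have lD x y : l (x + y) = l x + l y by rewrite -[x]scale1r llin mul1r scale1r.
have l0 : l 0 = 0 by apply: (addrI (l 0)); rewrite -lD !addr0.
have lZ a x : l (a *: x) = a * l x by have := llin a x 0; rewrite !addr0 l0 addr0.
have lB x y : l (x - y) = l x - l y by rewrite lD -scaleN1r lZ mulN1r.
(* the constant makes [f] nonnegative *)
pose f x : R := `|x| ^+ 2 - 2 * l x + M ^+ 2.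
have f_ge0 x : 0 <= f x.
  have := sqr_ge0 (`|x| - M); have := ler_norm (l x); have := lM x.
  by rewrite /f; move: `|l x| (l x) => p q; nra.
have f_cont : continuous f.
  move=> x; apply: cvgD; last exact: cvg_cst.
  apply: cvgB; first by rewrite expr2; apply: cvgM; apply: cvg_norm.
  apply: cvgMr.
  apply/cvgrPdist_le => e e0; near=> y.
  rewrite -lB; apply: (le_trans (lM _)).
  have xy : `|x - y| < e / (`|M| + 1).
    near: y; apply: (@cvgr_dist_lt _ _ _ (nbhs x)); first exact: cvg_id.
    by rewrite divr_gt0 // ltr_wpDl.
  have : `|x - y| * (`|M| + 1) < e by rewrite -ltr_pdivlMr // ltr_wpDl.
  have := ler_norm M; have := normr_ge0 (x - y).
  by move: `|x - y| `|M| => p q; nra.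
have [v vmin] : exists v, forall y, ((f v)%:E <= (f y)%:E)%E.
  apply: (@minimizer_exists _ _ (fun x => (f x)%:E) 4^-1) => //.
  - by move=> x a; rewrite lte_fin => ax; exists [set y | a < f y] => //=;
      exact: (cvgr_gt (f x) (f_cont x)).
  - by exists 0; rewrite ltry.
  - move=> x y; rewrite -!EFinD -EFinM lee_fin /f lZ lD normrZ exprMn normB2 normD2.
    by rewrite gtr0_norm ?invr_gt0 //; lra.
exists v => x; apply/eqP; rewrite -subr_eq0 -sqrf_eq0 eq_le sqr_ge0 andbT.
rewrite -(mul0r (`|x| ^+ 2)); apply: quadratic_discriminant => [|t].
  exact: sqr_ge0.
have := vmin (v - t *: x); rewrite lee_fin /f normB2 lB lZ innerZr normrZ exprMn.
by rewrite real_normK ?num_real //; lra.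
Unshelve. all: by end_near. Qed.

Lemma iter_homo_ltn (h : nat -> nat) m : (forall n, n < h n)%N ->
  {homo (fun n => iter n h m) : i j / (i < j)%N}.
Proof. by move=> hn; apply: homo_ltn => [? ? ?|n]; [exact: ltn_trans|exact: hn]. Qed.

Lemma homo_ltn_ge (f : nat -> nat) : {homo f : i j / (i < j)%N} ->
  forall n, (n <= f n)%N.
Proof.
by move=> hf; elim=> // n IH; exact: leq_ltn_trans IH (hf _ _ (ltnSn n)).
Qed.

(** The partial sums of an almost orthogonal bounded sequence grow like
    [Num.sqrt n], whereas inner products bounded below would make them grow like
    [n]. *)
Lemma almost_orthogonal_inner_not_ge w M d y :
  (forall i, `|w i| <= M) ->
  (forall i j, (i < j)%N -> `|inner (w j) (w i)| <= j%:R^-1) ->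
  0 < d -> ~ forall j, d <= inner (w j) y.
Proof.
move=> wM orth d0 dle.
have sum_le n : `|\sum_(i < n) w i| ^+ 2 <= n%:R * (M ^+ 2 + 2).
  elim: n => [|n IH]; first by rewrite big_ord0 normr0 mul0r expr0n.
  rewrite big_ord_recr /= normD2.
  have wn : `|w n| ^+ 2 <= M ^+ 2.
    by rewrite ler_sqr ?nnegrE // (le_trans _ (wM n)).
  have : inner (\sum_(i < n) w i) (w n) <= 1.
    rewrite inner_suml.
    apply: (@le_trans _ _ (\sum_(i < n) n%:R^-1)).
      apply: ler_sum => i _; rewrite innerC.
      exact: le_trans (ler_norm _) (orth _ _ (ltn_ord i)).
    rewrite sumr_const card_ord -[leLHS]mulr_natr.
    by case: n {IH wn} => [|n]; rewrite ?mulr0 // mulVf // pnatr_eq0.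
  by rewrite -natr1; move: IH wn; rewrite mulrDl mul1r; lra.
have sum_ge n : n%:R * d <= inner (\sum_(i < n) w i) y.
  rewrite inner_suml mulr_natl -[X in _ *+ X](card_ord n) -sumr_const.
  exact: ler_sum.
pose c := (M ^+ 2 + 2) * `|y| ^+ 2.
have bnd n : n%:R * d ^+ 2 <= c.
  case: n => [|n]; first by rewrite mul0r mulr_ge0 ?addr_ge0 ?sqr_ge0.
  have n0 : 0 < n.+1%:R :> R by rewrite ltr0n.
  rewrite -(ler_pM2l n0) /c mulrA -expr2 -exprMn mulrA.
  have h := le_trans (sum_ge n.+1) (inner_le _ _).
  apply: (@le_trans _ _ ((`|\sum_(i < n.+1) w i| * `|y|) ^+ 2)).
    by rewrite ler_sqr ?nnegrE ?mulr_ge0 // ltW.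
  by rewrite exprMn ler_wpM2r ?sqr_ge0 // sum_le.
have d2 : 0 < d ^+ 2 by rewrite exprn_gt0.
have c0 : 0 <= c / d ^+ 2 by rewrite divr_ge0 ?(ltW d2) // (le_trans _ (bnd 0)) ?mul0r.
have := bnd (Num.Def.archi_bound (c / d ^+ 2)).
rewrite -ler_pdivlMr // leNgt => /negP; apply; exact: archi_boundP.
Qed.

Lemma ultra_cvg_segment {T : Type} (U : set_system T) (f : T -> R) (c : R) :
  UltraFilter U -> (forall t, `|f t| <= c) -> exists a : R, f @ U --> a.
Proof.
move=> UU fc.
have FU : ProperFilter U by exact: ultra_proper.
have fseg : (f @ U) `[- c, c]%classic.
  by apply: (@nearW _ U) => t; rewrite /= in_itv /= -ler_norml.
have [a [_ cla]] := segment_compact (fmap_proper_filter f FU) fseg.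
exists a => V Va.
have [//|UVC] := in_ultra_setVsetC (f @^-1` V) UU.
by have [t []] := cla (~` V) V UVC Va.
Qed.

(** Weak limits are first taken along an ultrafilter, where boundedness
    suffices; the subsequence is then chosen so that its deviations from the
    limit are almost orthogonal to each other. *)
Lemma bounded_weak_subsequence w M : (forall i, `|w i| <= M) ->
  exists (f : nat -> nat) (x : X), {homo f : i j / (i < j)%N} /\
    weak_cvg \oo (w \o f) x.
Proof.
move=> wM.
have [U [UU Uoo]] := @ultraFilterLemma nat \oo _.
have FU : ProperFilter U by apply: ultra_proper.
have inner_bnd y k : `|inner (w k) y| <= M * `|y|.
  by apply: (le_trans (cauchy_schwarz _ _)); rewrite ler_wpM2r.
have /choice[l lP] y : exists a : R, inner (w k) y @[k --> U] --> a.
  exact: ultra_cvg_segment (inner_bnd y).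
have uniq (f : nat -> R) (a b : R) : f @ U --> a -> f @ U --> b -> a = b.
  move=> fa fb; exact: (cvg_unique (@norm_hausdorff R R) fa fb).
have llin a x y : l (a *: x + y) = a * l x + l y.
  apply: (uniq _ _ _ (lP _)).
  under eq_fun do rewrite innerDr innerZr.
  by apply: cvgD (lP y); apply: cvgMr; exact: lP.
have lM y : `|l y| <= M * `|y|.
  apply: (cvgr_to_le (cvg_norm (lP y))).
  by apply: nearW => k; exact: inner_bnd.
have [x lx] := riesz_representation _ _ llin lM.
pose z k := w k - x.
have zM k : `|z k| <= M + `|x|.
  by rewrite (le_trans (ler_normB _ _)) // lerD2r.
have zU y : inner (z k) y @[k --> U] --> 0.
  under eq_fun do rewrite innerBl.
  rewrite -(subrr (l y)); apply: cvgB (lP y) _; rewrite lx; exact: cvg_cst.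
have /choice[h hP] n : exists k, (n < k)%N /\
    forall i, (i <= n)%N -> `|inner (z k) (z i)| <= n.+1%:R^-1.
  have : U [set k | (n < k)%N /\
      forall i : 'I_n.+1, `|inner (z k) (z i)| <= n.+1%:R^-1].
    apply: filterI; first by apply: Uoo; exists n.+1.
    apply: filter_forall => i.

    have := zU (z i); move=> /cvgrPdist_le /(_ n.+1%:R^-1) H.
    apply: filterS (H _); last by rewrite invr_gt0.
    by move=> k; rewrite /= sub0r normrN.
  move=> /filter_ex[k [nk kP]]; exists k; split=> // i ni.
  exact: (kP (Ordinal (ni : (i < n.+1)%N))).
pose f n := iter n h 0%N.
have hn n : (n < h n)%N by have [] := hP n.
have fhomo : {homo f : i j / (i < j)%N} by exact: iter_homo_ltn.
have fge := homo_ltn_ge _ fhomo.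
have orth i j : (i < j)%N -> `|inner (z (f j)) (z (f i))| <= j%:R^-1.
  case: j => // j ij; have [_ /(_ (f i)) H] := hP (f j).
  apply: le_trans (H _) _.
    by move: ij; rewrite ltnS leq_eqVlt => /predU1P[->//|/fhomo/ltnW].
  by rewrite lef_pV2 ?posrE ?ltr0n // ler_nat ltnS fge.
have zlt y d : 0 < d -> \forall j \near \oo, inner (z (f j)) y < d.
  move=> d0; apply: contrapT => nfar.
  have /choice[g gP] n : exists j, (n < j)%N /\ d <= inner (z (f j)) y.
    apply: contrapT => H; apply: nfar; exists n.+1 => // j /= nj.
    by rewrite ltNge; apply/negP => ?; apply: H; exists j.
  pose e n := iter n g (g 0%N).
  have ehomo : {homo e : i j / (i < j)%N}.
    by apply: iter_homo_ltn => n; have [] := gP n.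
  apply: (@almost_orthogonal_inner_not_ge (fun n => z (f (e n))) _ d y).
  - by move=> i; exact: zM.
  - move=> i j ij; apply: (le_trans (orth _ _ (ehomo _ _ ij))).
    rewrite lef_pV2 ?posrE ?ltr0n ?(leq_ltn_trans _ ij) //.
      by rewrite ler_nat homo_ltn_ge.
    by rewrite (leq_trans _ (homo_ltn_ge _ ehomo j)) // (leq_ltn_trans _ ij).
  - exact: d0.
  - by case=> [|j]; [have [_ ?] := gP 0%N | have [_ ?] := gP (e j)].
exists f, x; split=> // y; apply/cvgrPdist_lt => d d0.
have := zlt y d d0; have := zlt (- y) d d0; apply: filterS2 => j /=.
rewrite innerNr -opprB normrN /z !innerBl => h1 h2.
by rewrite ltr_norml; apply/andP; split; lra.
Qed.

End weak_compactness.

(** * Existence of resolvents *)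

Section resolvent.
Context {R : realType} {X : hilbertType R}.
Implicit Types (x y : X) (E : X -> \bar R).

Lemma le0_of_le_small (a b : R) : (forall t, 0 < t <= 1 -> a <= t * b) -> a <= 0.
Proof.
move=> H; rewrite leNgt; apply/negP => a0.
have s0 : 0 < a + `|b| + 1 by rewrite ltr_wpDl ?addr_ge0 // ltW.
have h : 0 < a / (a + `|b| + 1) <= 1.
  by rewrite divr_gt0 // ler_pdivrMr // mul1r -addrA lerDl addr_ge0.
have := H _ h; have := ler_norm b; rewrite mulrAC ler_pdivlMr //.
by move: `|b| s0 => c s0 bc; nra.
Qed.

Lemma lower_semicontinuousD_continuous E (c : X -> R) :
  (forall x, 0 <= E x)%E -> lower_semicontinuous E -> continuous c ->
  lower_semicontinuous (fun x => (E x + (c x)%:E)%E).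
Proof.
move=> E0 lscE cc x a; rewrite -lteBlDr // -EFinB => axE.
have [b /andP[ab bE]] : exists b : R, (a - c x < b) && (b%:E < E x)%E.
  move: (E x) axE => [e| |] //.
    rewrite lte_fin => h; exists ((a - c x + e) / 2).
    by rewrite lte_fin; apply/andP; split; lra.
  by exists (a - c x + 1); rewrite ltrDl ltr01 ltry.
have [V Vx VE] := lscE x b bE.
exists (V `&` [set y | a - b < c y]).
  by apply: filterI Vx _; apply: cvgr_gt (cc x) _ _; lra.
move=> y [Vy /= h]; have := VE _ Vy; rewrite -lteBlDr // -EFinB.
by apply: lt_trans; rewrite lte_fin; lra.
Qed.

Lemma dom_fin_num E x : (0 <= E x)%E -> dom E x -> E x \is a fin_num.
Proof. by move=> E0; rewrite /dom /= ge0_fin_numE. Qed.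

Lemma le_pinfty_case (a b : \bar R) :
  ((b < +oo)%E -> (a <= b)%E) -> (a <= b)%E.
Proof.
by case: (ltP b +oo%E) => [_ /(_ isT)|+ _]; rewrite ?leye_eq // => /eqP->; rewrite leey.
Qed.

(** The resolvent of the subdifferential at [x] minimizes the Moreau-Yosida
    functional [E y + `|x - y| ^+ 2 / (2 * l)], uniformly convex at midpoints. *)
Lemma resolvent_exists E (l : R) x : convex_lsc E -> (exists y, dom E y) -> 0 < l ->
  exists j, subdifferential E j (l^-1 *: (x - j)).
Proof.
move=> [E0 cvxE lscE] [y0 domy0] l0.
pose c := (2 * l)^-1; have c0 : 0 < c by rewrite invr_gt0 mulr_gt0.
pose q y : R := c * `|x - y| ^+ 2.
pose F y : \bar R := (E y + (q y)%:E)%E.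
have q0 y : 0 <= q y by rewrite mulr_ge0 ?sqr_ge0 // ltW.
have qc : continuous q.
  move=> y; apply: cvgMr; rewrite expr2.
  have d : x - z @[z --> y] --> x - y by apply: cvgB; [exact: cvg_cst|exact: cvg_id].
  by apply: cvgM; exact: cvg_norm d.
have fine_dom y : (E y < +oo)%E -> E y = (fine (E y))%:E.
  by move=> ?; rewrite fineK // ge0_fin_numE.
have [j jmin] : exists j, forall y, (F j <= F y)%E.
  apply: (@minimizer_exists _ _ F (c / 4)).
  - by rewrite divr_gt0.
  - by move=> y; rewrite adde_ge0 // lee_fin.
  - exact: lower_semicontinuousD_continuous.
  - by exists y0; rewrite /F fine_dom // -EFinD ltry.
  - move=> y z.
    have F_nNy u : (F u != -oo)%E.
      by rewrite gt_eqF // (lt_le_trans (ltNyr 0)) // adde_ge0 // lee_fin.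
    have FT u : (+oo <= E u)%E -> F u = +oo%E.
      by rewrite leye_eq /F => /eqP ->; rewrite addye.
    have half_y : ((2^-1)%:E * +oo = +oo :> \bar R)%E.
      by rewrite gt0_muley // lte_fin invr_gt0.
    have [yo|/FT ->] := ltP (E y) +oo%E; last by rewrite addye // half_y leey.
    have [zo|/FT ->] := ltP (E z) +oo%E; last by rewrite addey // half_y leey.
    have := cvxE 2^-1 y z; rewrite (_ : 1 - 2^-1 = 2^-1 :> R); last by field.
    rewrite -scalerDr /F (fine_dom _ yo) (fine_dom _ zo) -!EFinM -!EFinD => H.
    have {}H := H _.
    apply: (le_trans (leeD (leeD (H _) (lexx _)) (lexx _))).
      by rewrite invr_ge0 ler0n invf_le1 // ler1n.
    rewrite -!EFinD lee_fin /q.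
    have par : `|x - 2^-1 *: (y + z)| ^+ 2 + 4^-1 * `|y - z| ^+ 2
             = 2^-1 * `|x - y| ^+ 2 + 2^-1 * `|x - z| ^+ 2.
      by rewrite -!inner_norm !innerE !(innerC y x, innerC z x, innerC z y); field.
    have := congr1 (fun r => c * r) par; rewrite /= !mulrDr.
    move: (`|x - 2^-1 *: (y + z)| ^+ 2) (`|y - z| ^+ 2) (`|x - y| ^+ 2).
    by move: (`|x - z| ^+ 2) => *; nra.
have jdom : (E j < +oo)%E.
  rewrite (le_lt_trans _ (le_lt_trans (jmin y0) _)) //.
    by rewrite leeDl // lee_fin.
  by rewrite /F fine_dom // -EFinD ltry.
exists j; split=> // y; apply: le_pinfty_case => yo.
rewrite (fine_dom _ jdom) (fine_dom _ yo) -EFinD lee_fin -subr_le0.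
apply: (@le0_of_le_small _ (c * `|y - j| ^+ 2)) => t /andP[t0 t1].
have := jmin (t *: y + (1 - t) *: j) => /le_trans.
have := cvxE t y j; rewrite t1 ltW // => /(_ isT).
rewrite (fine_dom _ jdom) (fine_dom _ yo) -!EFinM -!EFinD => h.
move=> /(_ _ (leeD h (lexx _))).
rewrite /F (fine_dom _ jdom) -!EFinD lee_fin /q.
have -> : x - (t *: y + (1 - t) *: j) = (x - j) - t *: (y - j).
  by rewrite scalerBr scalerBl scale1r opprD opprB !opprD opprK; rewrite -!addrA;
     congr (x + _); rewrite addrC -!addrA; congr (_ + _); rewrite addrC.
rewrite (normB2 (x - j)) innerZr normrZ exprMn real_normK ?num_real // innerZl.
have -> : l^-1 = 2 * c by rewrite /c invfM mulrA mulfV ?mul1r // pnatr_eq0.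
move=> H; rewrite -(ler_pM2l t0); move: H.
by move: (`|x - j| ^+ 2) (`|y - j| ^+ 2) (inner _ _) => *; nra.
Qed.

End resolvent.

(** * Strong convergence along operators between varying Hilbert spaces *)

Section limf_esup.
Context {R : realType} {T : choiceType} {Y : filteredType T}.
Implicit Types (f : Y -> \bar R) (F : set_system Y) (a : \bar R).

Lemma limf_esup_lt_near f F {FF : Filter F} a : (limf_esup f F < a)%E ->
  \forall t \near F, (f t < a)%E.
Proof.
move=> /ereal_inf_lt[_ [V FV <-] Va]; apply: filterS FV => t Vt.
by apply: le_lt_trans Va; apply: ereal_sup_ubound; exists t.
Qed.

Lemma limf_esup_le f F a : F setT -> (forall t, f t <= a)%E -> (limf_esup f F <= a)%E.
Proof.
move=> FT fa; apply: (@le_trans _ _ (ereal_sup [set f t | t in setT])).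
  by apply: ereal_inf_lbound; exists setT.
by apply: ge_ereal_sup => _ [t _ <-].
Qed.

End limf_esup.

Section strong_convergence.
Context {R : realType} {X0 : hilbertType R} {X : R -> hilbertType R}.
Variable L : forall eps : R, {linear X eps -> X0}.
Hypothesis L_mosco : (limf_esup (fun eps => opnorm (L eps)) 0^'+ <= 1)%E.

Lemma opnorm_ge0 eps : (0 <= opnorm (L eps))%E.
Proof.
by apply: ereal_sup_ubound; exists 0; rewrite /= ?normr0 ?ler01 // linear0 normr0.
Qed.

Lemma le_opnorm eps a x : (opnorm (L eps) <= a%:E)%E -> `|L eps x| <= a * `|x|.
Proof.
move=> opa; have [->|x0] := eqVneq x 0; first by rewrite linear0 !normr0 mulr0.
have nx : 0 < `|x| by rewrite normr_gt0.
rewrite -ler_pdivrMr // -lee_fin; apply: le_trans opa.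
apply: ereal_sup_ubound; exists (`|x|^-1 *: x).
  by rewrite /= normrZ normfV normr_id mulVf // gt_eqF.
by rewrite linearZ /= normrZ normfV normr_id mulrC.
Qed.

(** The upper limit of the operator norms enters only through a bound by a
    function that tends to 1, which can be used pointwise and in limits. *)
Lemma mosco_bound : exists a : R -> R,
  [/\ forall e, 1 <= a e, a e @[e --> 0^'+] --> (1 : R)
    & \forall e \near 0^'+, forall x, `|L e x| <= a e * `|x|].
Proof.
exists (fun e => Num.max 1 (fine (opnorm (L e)))).
have near_op d : 0 < d -> \forall e \near 0^'+, (opnorm (L e) < (1 + d)%:E)%E.
  move=> d0; apply: limf_esup_lt_near; apply: (le_lt_trans L_mosco).
  by rewrite lte_fin ltrDl.
have fin_op e d : (opnorm (L e) < (1 + d)%:E)%E ->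
    opnorm (L e) = (fine (opnorm (L e)))%:E.
  by move=> h; rewrite fineK // ge0_fin_numE ?opnorm_ge0 // (lt_trans h) ?ltry.
split.
- by move=> e; rewrite le_max lexx.
- apply/cvgrPdist_le => d d0; apply: filterS (near_op d d0) => e h.
  move: (h); rewrite (fin_op _ _ h) lte_fin => /ltW h1.
  rewrite distrC ger0_norm ?subr_ge0 ?le_max ?lexx // lerBlDl ge_max h1 andbT.
  by rewrite lerDl ltW.
- apply: filterS (near_op 1 ltr01) => e h x; apply: le_opnorm.
  by rewrite (fin_op _ _ h) lee_fin le_max lexx orbT.
Qed.

Section along_filter.
Context {T : Type} {F : set_system T} {FF : ProperFilter F} (eps : T -> R).
Hypothesis eps_cvg : eps @ F --> 0^'+.
Implicit Types x y : forall t, X (eps t).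

Lemma cvg_inner_strong_weak (f g : T -> X0) (u v : X0) (M : R) :
  f @ F --> u -> (\forall t \near F, `|g t| <= M) -> weak_cvg F g v ->
  inner (f t) (g t) @[t --> F] --> inner u v.
Proof.
move=> fu gM gv.
have -> : (fun t => inner (f t) (g t)) =
          (fun t => inner (f t - u) (g t) + inner (g t) u).
  by apply/funext => t; rewrite innerBl (innerC (g t)) subrK.
rewrite -[X in _ --> X]add0r innerC; apply: cvgD (gv u).
apply/norm_cvg0P.
apply: (@squeeze_cvgr _ _ _ _ (fun=> 0) (fun t => `|f t - u| * M)).
- apply: filterS gM => t h; rewrite normr_ge0 /=.
  by apply: (le_trans (cauchy_schwarz _ _)); rewrite ler_wpM2l.
- exact: cvg_cst.
- rewrite -(mul0r M); apply: cvgMl.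
  rewrite -(normr0 X0) -(subrr u); apply: cvg_norm; apply: cvgB fu _.
  exact: cvg_cst.
Qed.

(** The form [a ^+ 2 * inner x y - inner (L x) (L y)] is positive semidefinite
    for [a] bounding the norm of [L]; along a strongly convergent family its
    diagonal tends to 0, hence so do its values against bounded families. *)
Lemma cvg_inner_strong x y (x0 y0 : X0) (M : R) :
  `|x t| @[t --> F] --> `|x0| -> L (eps t) (x t) @[t --> F] --> x0 ->
  (\forall t \near F, `|y t| <= M) ->
  weak_cvg F (fun t => L (eps t) (y t)) y0 ->
  inner (x t) (y t) @[t --> F] --> inner x0 y0.
Proof.
move=> nx Lx yM Ly.
have [a [a1 acvg aL]] := mosco_bound.
have {acvg}acvg : a (eps t) @[t --> F] --> (1 : R) by exact: cvg_comp eps_cvg acvg.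
have {}aL : \forall t \near F, forall z, `|L (eps t) z| <= a (eps t) * `|z|.
  by have := @eps_cvg _ aL.
have a0 t : 0 < a (eps t) by exact: lt_le_trans ltr01 (a1 _).
pose b t := a (eps t) ^+ 2.
have bcvg : b @ F --> (1 : R).
  by rewrite -[X in _ --> X](mulr1 1); apply: cvgM.
pose B t (u v : X (eps t)) := b t * inner u v - inner (L (eps t) u) (L (eps t) v).
(* bounds [B t (x t) (y t) ^+ 2] once [a (eps t) < 2] *)
pose r t := B t (x t) (x t) * (2 * M) ^+ 2.
have r_cvg : r @ F --> (0 : R).
  rewrite /r -[X in _ --> X](mul0r ((2 * M) ^+ 2)); apply: cvgMl.
  rewrite /B (_ : 0 = 1 * inner x0 x0 - inner x0 x0); last by rewrite mul1r subrr.
  apply: cvgB; last exact: cvg_inner.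
  apply: cvgM => //; rewrite inner_norm; under eq_fun do rewrite inner_norm.
  by rewrite !expr2; apply: cvgM.
have B_cvg : B t (x t) (y t) @[t --> F] --> (0 : R).
  apply/cvgr0Pnorm_lt => d d0.
  have a2 : \forall t \near F, a (eps t) < 2 by apply: (cvgr_lt 1) => //; rewrite ltr1n.
  have rd : \forall t \near F, r t < d ^+ 2.
    by apply: (cvgr_lt 0) => //; rewrite exprn_gt0.
  near=> t.
  have Lt : forall z, `|L (eps t) z| <= a (eps t) * `|z| by near: t.
  rewrite -ltr_sqr ?nnegrE ?(ltW d0) // real_normK ?num_real //.
  apply: (@le_lt_trans _ _ (r t)); last by near: t.
  have Bpos u : 0 <= B t u u.
    rewrite /B !inner_norm subr_ge0 -exprMn ler_sqr ?nnegrE ?mulr_ge0 // ?(ltW (a0 t)) //.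
  apply: (@le_trans _ _ (B t (x t) (x t) * B t (y t) (y t))).
    apply: quadratic_discriminant => // s.
    have := Bpos (x t + s *: y t).
    by rewrite /B linearD linearZ /= !innerE (innerC (y t) (x t))
      (innerC (L _ (y t)) (L _ (x t))) => h; apply: le_trans h _; rewrite le_eqVlt;
      apply/orP; left; apply/eqP; ring.
  rewrite ler_wpM2l //.
  apply: (@le_trans _ _ (b t * `|y t| ^+ 2)).
    by rewrite /B !inner_norm lerBlDr lerDl sqr_ge0.
  rewrite /b -exprMn ler_sqr ?nnegrE ?mulr_ge0 ?(ltW (a0 t)) //.
    by apply: ler_pM => //; [exact: ltW|apply: ltW; near: t|near: t].
  by apply: (@le_trans _ _ `|y t|) => //; near: t.
have LL : inner (L (eps t) (x t)) (L (eps t) (y t)) @[t --> F] --> inner x0 y0.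
  apply: (@cvg_inner_strong_weak _ _ _ _ (2 * M)) => //.
  near=> t.
  have Lt : forall z, `|L (eps t) z| <= a (eps t) * `|z| by near: t.
  apply: (le_trans (Lt _)); apply: ler_pM => //; first exact: ltW.
    by apply: ltW; near: t; apply: (cvgr_lt 1) => //; rewrite ltr1n.
  by near: t.
have -> : (fun t => inner (x t) (y t)) = (fun t =>
    (B t (x t) (y t) + inner (L (eps t) (x t)) (L (eps t) (y t))) * (b t)^-1).
  apply/funext => t; rewrite /B subrK mulrAC mulfV ?mul1r //.
  by rewrite /b expf_neq0 // gt_eqF.
rewrite -[X in _ --> X](mulr1 (inner x0 y0)); apply: cvgM.
  by rewrite -[X in _ --> X]add0r; apply: cvgD.
by rewrite -[X in _ --> X]invr1; apply: cvgV => //; rewrite oner_neq0.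
Unshelve. all: by end_near. Qed.

End along_filter.
End strong_convergence.

(** * Strong convergence of resolvents *)

Section mosco_resolvents.
Context {R : realType} {X0 : hilbertType R} {X : R -> hilbertType R}.
Variable L : forall eps : R, {linear X eps -> X0}.
Hypothesis L_mosco : (limf_esup (fun eps => opnorm (L eps)) 0^'+ <= 1)%E.
Implicit Types x y z : forall eps, X eps.

Lemma near_norm_le {T : Type} {F : set_system T} {FF : Filter F} (f : T -> R) (a : R) :
  f @ F --> a -> \forall t \near F, f t <= a + 1.
Proof. by move=> fa; apply: (cvgr_le _ fa); rewrite ltrDl. Qed.

Lemma strong_cvgB x y (x0 y0 : X0) : strong_cvg L x x0 -> strong_cvg L y y0 ->
  strong_cvg L (fun e => x e - y e) (x0 - y0).
Proof.
move=> [nx Lx] [ny Ly]; split; last first.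
  by under eq_fun do rewrite linearB; apply: cvgB.
have ixy : inner (x e) (y e) @[e --> 0^'+] --> inner x0 y0.
  apply: (@cvg_inner_strong _ _ _ L L_mosco _ _ _ id _ x y x0 y0 (`|y0| + 1)) => //.
    exact: near_norm_le.
  by move=> z; apply: cvg_inner Ly _; exact: cvg_cst.
have sq : `|x e - y e| ^+ 2 @[e --> 0^'+] --> `|x0 - y0| ^+ 2.
  rewrite normB2; under eq_fun do rewrite normB2.
  rewrite !expr2; apply: cvgD; last exact: cvgM.
  by apply: cvgB; [exact: cvgM|apply: cvgMr].
rewrite -(ger0_norm (normr_ge0 (x0 - y0))) -sqrtr_sqr.
have -> : (fun e => `|x e - y e|) = (fun e => Num.sqrt (`|x e - y e| ^+ 2)).
  by apply/funext => e; rewrite sqrtr_sqr normr_id.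
by apply: cvg_comp sq _; exact: sqrt_continuous.
Qed.

Lemma strong_cvg_close x z (x0 : X0) : strong_cvg L z x0 ->
  `|x e - z e| @[e --> 0^'+] --> (0 : R) -> strong_cvg L x x0.
Proof.
move=> [nz Lz] xz; split.
  have -> : (fun e => `|x e|) = (fun e => (`|x e| - `|z e|) + `|z e|).
    by apply/funext => e; rewrite subrK.
  rewrite -[X in _ --> X]add0r; apply: cvgD nz.
  apply/norm_cvg0P; apply: (@squeeze_cvgr _ _ _ _ (fun=> 0) _ _ _ _ _ xz).
    by apply: nearW => e; rewrite normr_ge0 ler_dist_dist.
  exact: cvg_cst.
have -> : (fun e => L e (x e)) = (fun e => L e (x e - z e) + L e (z e)).
  by apply/funext => e; rewrite linearB subrK.
rewrite -[X in _ --> X]add0r; apply: cvgD Lz.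
have [a [a1 acvg aL]] := mosco_bound L L_mosco.
apply/norm_cvg0P.
apply: (@squeeze_cvgr _ _ _ _ (fun=> 0) (fun e => a e * `|x e - z e|)).
- by apply: filterS aL => e h; rewrite normr_ge0 h.
- exact: cvg_cst.
- by rewrite -[X in _ --> X](mulr0 1); apply: cvgM.
Qed.

Context (E : forall eps : R, X eps -> \bar R) (E0 : X0 -> \bar R).
Hypothesis E_ge0 : forall eps, 0 < eps -> forall u, (0 <= E eps u)%E.
Hypothesis E0_ge0 : forall u, (0 <= E0 u)%E.
Hypothesis E_mosco : mosco_functionals L E E0.

(** The inequality defining the resolvent, tested with a recovery sequence [z] of
    [j0], bounds the squared distance from [z] to [j] by a difference of energies
    and an inner product that pairs a strongly with a weakly convergent sequence.
    If the distance stayed away from 0 along some sequence, a weak limit [w0] of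
    the resolvents along it would, by the lower bound for the energies, contradict
    the inequality defining [j0] at [w0]. *)
Lemma resolvent_strong_cvg (l : R) x (j : forall eps, X eps) (x0 j0 : X0) :
  0 < l -> strong_cvg L x x0 ->
  (\forall e \near 0^'+, subdifferential (E e) (j e) (l^-1 *: (x e - j e))) ->
  subdifferential E0 j0 (l^-1 *: (x0 - j0)) ->
  strong_cvg L j j0.
Proof.
move=> l0 xs jP [dom0 j0P].
have li0 : 0 < l^-1 by rewrite invr_gt0.
have [Einf /(_ _ dom0)[z [zs Ez]]] := E_mosco.
apply: (strong_cvg_close _ _ _ zs).
have xz := strong_cvgB _ _ _ _ xs zs.
pose q := fine (E0 j0).
have E0q : E0 j0 = q%:E by rewrite /q fineK // dom_fin_num.
pose p e := fine (E e (z e)).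
have pq : p @ 0^'+ --> q by move: Ez; rewrite E0q => /fine_cvgP[].
have fz : \forall e \near 0^'+, E e (z e) = (p e)%:E.
  move: Ez; rewrite E0q => /fine_cvgP[fz _].
  by apply: filterS fz => e ?; rewrite /p fineK.
have [a [a1 acvg aL]] := mosco_bound L L_mosco.
(* the defining inequality of the resolvent, tested with the recovery sequence *)
have main : \forall e \near 0^'+, exists2 s : R, E e (j e) = s%:E &
    0 <= s /\ s + l^-1 * (`|z e - j e| ^+ 2 + inner (x e - z e) (z e - j e)) <= p e.
  near=> e.
  have [domj /(_ (z e))] : subdifferential (E e) (j e) (l^-1 *: (x e - j e)).
    by near: e.
  have -> : E e (z e) = (p e)%:E by near: e.
  have e0 : 0 < e by near: e; exact: nbhs_right_gt.
  have fj := dom_fin_num _ _ (E_ge0 _ e0 _) domj.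
  rewrite -(fineK fj) -EFinD lee_fin innerZl.
  have -> : inner (x e - j e) (z e - j e)
      = `|z e - j e| ^+ 2 + inner (x e - z e) (z e - j e).
    by rewrite -inner_norm !innerE; ring.
  move=> h; exists (fine (E e (j e))); rewrite ?fineK //.
  by split=> //; rewrite fine_ge0 // E_ge0.
pose m := `|x0 - j0| + 1.
(* [`|z e - j e| ^+ 2 <= M] follows from [main] after absorbing the inner product *)
pose M := 2 * l * (q + 1) + m ^+ 2.
pose N := `|j0| + 1 + (M + 1).
have bounds : \forall e \near 0^'+, [/\ `|z e - j e| <= M + 1, `|j e| <= N & `|L e (j e)| <= 2 * N].
  have xzm := near_norm_le _ _ xz.1.
  have zm := near_norm_le _ _ zs.1.
  have pm := near_norm_le _ _ pq.
  near=> e.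
  have [s _ [s0 se]] : exists2 s : R, E e (j e) = s%:E & 0 <= s /\
      s + l^-1 * (`|z e - j e| ^+ 2 + inner (x e - z e) (z e - j e)) <= p e.
    by near: e.
  have pe : p e <= q + 1 by near: e; exact: pm.
  have me : `|x e - z e| <= m by near: e; exact: xzm.
  have ze : `|z e| <= `|j0| + 1 by near: e; exact: zm.
  have Le : forall u, `|L e u| <= a e * `|u| by near: e.
  have ae : a e <= 2.
    by apply: ltW; near: e; apply: (cvgr_lt 1) => //; rewrite ltr1n.
  have zj : `|z e - j e| <= M + 1.
    have h1 : l^-1 * (`|z e - j e| ^+ 2 + inner (x e - z e) (z e - j e)) <= q + 1.
      by apply: le_trans pe; apply: le_trans se; rewrite lerDr.
    have h2 : `|z e - j e| ^+ 2 + inner (x e - z e) (z e - j e) <= l * (q + 1).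
      by rewrite -ler_pdivrMl.
    have h3 := cauchy_schwarz (x e - z e) (z e - j e).
    have h4 := ler_norm (- inner (x e - z e) (z e - j e)).
    rewrite normrN in h4.
    have h5 : `|x e - z e| * `|z e - j e| <= m * `|z e - j e| by rewrite ler_wpM2r.
    have h6 := sqr_ge0 (m - `|z e - j e|).
    have h7 := sqr_ge0 (`|z e - j e| - 1).
    rewrite /M; move: h2 h3 h4 h5 h6 h7.
    move: (inner _ _) (`|inner _ _|) (`|z e - j e|) (`|x e - z e|) => *; nra.
  have jN : `|j e| <= N.
    have -> : j e = z e - (z e - j e) by rewrite opprB addrC subrK.
    by apply: (le_trans (ler_normB _ _)); rewrite lerD.
  split=> //; apply: (le_trans (Le _)); apply: ler_pM => //.
  exact: le_trans ler01 (a1 e).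
apply/cvgr0Pnorm_lt => d d0; apply: contrapT => nfar.
have /choice[ek ekP] n : exists e : R, [/\ 0 < e, e < n.+1%:R^-1,
    [/\ `|z e - j e| <= M + 1, `|j e| <= N & `|L e (j e)| <= 2 * N],
    exists2 s : R, E e (j e) = s%:E & 0 <= s /\
      s + l^-1 * (`|z e - j e| ^+ 2 + inner (x e - z e) (z e - j e)) <= p e
    & d <= `|z e - j e| ].
  apply: contrapT => H; apply: nfar; near=> e.
  rewrite normr_id distrC ltNge; apply/negP => de; apply: H; exists e; split=> //.
  - by near: e.
  - by near: e.
have [f [w0 [fhomo wcvg]]] : exists (f : nat -> nat) (w0 : X0),
    {homo f : i k / (i < k)%N} /\ weak_cvg \oo (fun k => L _ (j (ek (f k)))) w0.
  apply: (@bounded_weak_subsequence _ _ (fun k => L _ (j (ek k))) (2 * N)) => k.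
  by have [_ _ []] := ekP k.
pose eps k := ek (f k).
have eps_gt0 k : 0 < eps k by have [] := ekP (f k).
have eps0 : eps @ \oo --> (0 : R).
  apply/cvgr0Pnorm_lt => c c0.
  have [k0 _ H] := near_infty_natSinv_lt (PosNum c0).
  exists k0 => // k /= kk; rewrite gtr0_norm //.
  have [_ h _ _ _] := ekP (f k); apply: (lt_trans h); apply: H => /=.
  exact: leq_trans kk (homo_ltn_ge _ fhomo k).
have eps0r : eps @ \oo --> 0^'+.
  by move=> A hA; apply: (@filterS _ \oo _ _ _ _ (eps0 _ hA)) => k; apply; exact: eps_gt0.
(* the value that the inequality of [j0] imposes on [E0 w0], lowered by half of what
   a distance [d] costs in [main] *)
pose r := q + l^-1 * inner (x0 - j0) (w0 - j0) - l^-1 * d ^+ 2 / 2.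
have ld : 0 < l^-1 * d ^+ 2 by rewrite mulr_gt0 // exprn_gt0.
have rE : (r%:E < limn_einf (fun k => E _ (j (eps k))))%E.
  apply: (@lt_le_trans _ _ (E0 w0)).
    apply: lt_le_trans (j0P w0).
    by rewrite E0q -EFinD lte_fin /r innerZl ltrBlDr ltrDl divr_gt0.
  apply: Einf => //.
  apply: (@le_lt_trans _ _ N%:E); last exact: ltry.
  apply: limf_esup_le => [|k]; first exact: filterT.
  by have [_ _ [_ jN _]] := ekP (f k); rewrite lee_fin.
have rnear : \forall k \near \oo, (r%:E < E _ (j (eps k)))%E.
  move: rE; rewrite /limn_einf /limn_esup lteNr => /limf_esup_lt_near.
  by apply: filterS => k; rewrite lteN2.
have icvg : inner (x (eps k) - z (eps k)) (z (eps k) - j (eps k)) @[k --> \oo]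
    --> inner (x0 - j0) (j0 - w0).
  apply: (@cvg_inner_strong _ _ _ L L_mosco _ _ _ eps eps0r
    (fun k => x (eps k) - z (eps k)) (fun k => z (eps k) - j (eps k)) _ _ (M + 1)).
  - exact: cvg_comp eps0r xz.1.
  - exact: cvg_comp eps0r xz.2.
  - by apply: nearW => k; have [_ _ []] := ekP (f k).
  - move=> y; rewrite innerBl; under eq_fun do rewrite linearB innerBl.
    apply: cvgB; last exact: wcvg.
    by apply: cvg_inner; [exact: cvg_comp eps0r zs.2|exact: cvg_cst].
have gcvg : p (eps k) - l^-1 * inner (x (eps k) - z (eps k)) (z (eps k) - j (eps k))
    @[k --> \oo] --> q - l^-1 * inner (x0 - j0) (j0 - w0).
  by apply: cvgB; [exact: cvg_comp eps0r pq|apply: cvgMr].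
have := cvgr_to_ge gcvg (b := r + l^-1 * d ^+ 2).
have -> : inner (x0 - j0) (j0 - w0) = - inner (x0 - j0) (w0 - j0).
  by rewrite -innerNr opprB.
suff H : \forall k \near \oo, r + l^-1 * d ^+ 2 <=
    p (eps k) - l^-1 * inner (x (eps k) - z (eps k)) (z (eps k) - j (eps k)).
  by move=> /(_ _ H); rewrite /r; lra.
apply: filterS rnear => k rk.
have [_ _ _ [s Es [_ se]] dk] := ekP (f k).
move: rk; rewrite /eps Es lte_fin => rs.
have d2 : l^-1 * d ^+ 2 <= l^-1 * `|z (ek (f k)) - j (ek (f k))| ^+ 2.
  by rewrite ler_pM2l // ler_sqr ?nnegrE // ltW.
by move: se; rewrite mulrDr; lra.
Unshelve. all: by end_near. Qed.

End mosco_resolvents.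

(** * Real-valued Lebesgue integrals *)

Section real_integrals.
Context {R : realType}.
Local Notation mu := (@lebesgue_measure R).
Local Notation integrable_on D f := (mu.-integrable D (EFin \o f)).
Implicit Types (D P : set R) (f g : R -> R) (c : R).

Lemma integrable_onD D f g : measurable D -> integrable_on D f -> integrable_on D g ->
  integrable_on D (fun t => f t + g t).
Proof. by move=> mD fi gi; exact: integrableD fi gi. Qed.

Lemma integrable_onB D f g : measurable D -> integrable_on D f -> integrable_on D g ->
  integrable_on D (fun t => f t - g t).
Proof. by move=> mD fi gi; exact: integrableB fi gi. Qed.

Lemma integrable_onZ D f c : measurable D -> integrable_on D f ->
  integrable_on D (fun t => c * f t).
Proof. by move=> mD fi; exact: integrableZl fi. Qed.

Lemma integrable_onS D P f : measurable D -> measurable P -> P `<=` D ->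
  integrable_on D f -> integrable_on P f.
Proof. by move=> mD mP PD; exact: integrableS. Qed.

Lemma integrable_on_abs D f : measurable D -> integrable_on D f ->
  integrable_on D (fun t => `|f t|).
Proof. by move=> mD; exact: integrable_abse. Qed.

Lemma integrable_on_sum {I : Type} (s : seq I) D (h : I -> R -> R) : measurable D ->
  (forall i, integrable_on D (h i)) ->
  integrable_on D (fun t => \sum_(i <- s) h i t) /\
  \int[mu]_(t in D) (\sum_(i <- s) h i t) = \sum_(i <- s) \int[mu]_(t in D) h i t.
Proof.
move=> mD hi; elim: s => [|i s [IHi IH]].
  under [X in integrable_on _ X]eq_fun do rewrite big_nil.
  under eq_Rintegral do rewrite big_nil.
  rewrite big_nil Rintegral_cst // mul0r; split=> //.
  exact: (integrable0 mu D).
under [X in integrable_on _ X]eq_fun do rewrite big_cons.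
under eq_Rintegral do rewrite big_cons.
by split; [exact: integrable_onD|rewrite RintegralD // IH big_cons].
Qed.

Lemma restrict_support {V : pointedType} D P (f : R -> V) : P `<=` D ->
  (forall t, D t -> ~ P t -> f t = point) -> f \_ D = f \_ P.
Proof.
move=> PD f0; apply/funext => t; rewrite !patchE.
have [Pt|Pt] := boolP (t \in P).
  by rewrite ifT // inE; apply: PD; rewrite inE in Pt.
have [Dt|//] := boolP (t \in D); apply: f0.
  by rewrite inE in Dt.
by rewrite notin_setE in Pt.
Qed.

Lemma integrable_support D P f : measurable D -> measurable P -> P `<=` D ->
  (forall t, D t -> ~ P t -> f t = 0) -> integrable_on P f -> integrable_on D f.
Proof.
move=> mD mP PD f0 fi.
apply: (iffRL (integrable_mkcond (mu := mu) (EFin \o f) mD)).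
rewrite (restrict_support D P) //; last by move=> t Dt Pt /=; rewrite f0.
exact: (iffLR (integrable_mkcond (mu := mu) (EFin \o f) mP)).
Qed.

Lemma Rintegral_support D P f : P `<=` D -> (forall t, D t -> ~ P t -> f t = 0) ->
  \int[mu]_(t in D) f t = \int[mu]_(t in P) f t.
Proof.
by move=> PD f0; rewrite Rintegral_mkcond (restrict_support D P) // -Rintegral_mkcond.
Qed.

Lemma integrable_indic D (A : set R) : measurable D -> measurable A ->
  (mu A < +oo)%E -> integrable_on D (\1_A : R -> R).
Proof.
move=> mD mA Afin; apply/integrableP; split.
  exact/measurable_EFinP/measurable_indic.
under eq_integral do rewrite /= ger0_norm //.
rewrite integral_indic //; apply: le_lt_trans Afin.
by apply: le_measure; rewrite ?inE //; exact: measurableI.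
Qed.

Lemma Rintegral_indic D (A : set R) : measurable D -> measurable A ->
  \int[mu]_(t in D) (\1_A t : R) = fine (mu (A `&` D)).
Proof. by move=> mD mA; rewrite /Rintegral integral_indic. Qed.

Lemma Rintegral_indic_itv_le D (p q : R) : measurable D -> p <= q ->
  \int[mu]_(t in D) (\1_(`[p, q]%classic) t : R) <= q - p.
Proof.
move=> mD pq; rewrite Rintegral_indic //.
have muI : mu (`[p, q]%classic) = (q - p)%:E.
  by rewrite lebesgue_measure_itv /= lte_fin; case: ltgtP pq => // -> _; rewrite subrr.
have le_mu : (mu (`[p, q]%classic `&` D) <= (q - p)%:E)%E.
  rewrite -muI; apply: le_measure; rewrite ?inE //.
  exact: measurableI.
rewrite -lee_fin fineK // ge0_fin_numE //; exact: le_lt_trans le_mu (ltry _).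
Qed.

Lemma le_abs_Rintegral D f g : measurable D -> integrable_on D f -> integrable_on D g ->
  (forall t, D t -> `|f t| <= g t) -> `|\int[mu]_(t in D) f t| <= \int[mu]_(t in D) g t.
Proof.
move=> mD fi gi fg; apply: (le_trans (le_normr_Rintegral (mu := mu) mD fi)).
by apply: le_Rintegral => //; exact: integrable_on_abs.
Qed.

Lemma ae_imply (A B : R -> Prop) : (forall t, A t -> B t) ->
  {ae mu, forall t, A t} -> {ae mu, forall t, B t}.
Proof. by move=> AB; apply: (@filterS _ _ (ae_filter_ringOfSetsType mu)). Qed.

(** The maximum of [f] and [g] dominates [f] everywhere and has the same integral
    as [g]. *)
Lemma ae_le_Rintegral D f g : measurable D -> integrable_on D f -> integrable_on D g ->
  {ae mu, forall t, D t -> f t <= g t} ->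
  \int[mu]_(t in D) f t <= \int[mu]_(t in D) g t.
Proof.
move=> mD fi gi fg.
pose h t := Num.max (f t) (g t).
have hi : integrable_on D h.
  have -> : h = fun t => 2^-1 * (f t + g t + `|f t - g t|).
    by apply/funext => t; rewrite /h maxr_absE mulrC.
  apply: integrable_onZ => //; apply: integrable_onD => //; first exact: integrable_onD.
  by apply: integrable_on_abs => //; exact: integrable_onB.
have -> : \int[mu]_(t in D) g t = \int[mu]_(t in D) h t.
  congr fine; apply: ae_eq_integral => //.
  - by have /integrableP[] := gi.
  - by have /integrableP[] := hi.
  - by apply: ae_imply fg => t le_fg Dt; rewrite /h max_r // le_fg.
by apply: le_Rintegral => // t _; rewrite le_max lexx.
Qed.

End real_integrals.

(** * Testing a weak derivative against a vector *)

Section bochner_inner.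
Context {R : realType} {X : hilbertType R}.
Local Notation mu := (@lebesgue_measure R).
Local Notation integrable_on D f := (mu.-integrable D (EFin \o f)).
Implicit Types (D P : set R) (s : @simple_function R X) (y : X) (F k : R -> R).

Lemma inner_sf_eval s y t :
  inner (sf_eval s t) y = \sum_(i < sf_size s) inner (sf_val i) y * \1_(sf_set i) t.
Proof. by rewrite inner_suml; apply: eq_bigr => i _; rewrite innerZl mulrC. Qed.

Lemma norm_sf_eval_le s t : `|sf_eval s t| <= \sum_(i < sf_size s) `|sf_val i|.
Proof.
apply: (le_trans (ler_norm_sum _ _ _)); apply: ler_sum => i _.
rewrite normrZ -[leRHS]mul1r ler_wpM2r // indicE.
by case: (_ \in _); rewrite ?normr1 ?normr0.
Qed.

Lemma Rintegral_inner_sf_eval D s y : measurable D ->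
  integrable_on D (fun t => inner (sf_eval s t) y) /\
  \int[mu]_(t in D) inner (sf_eval s t) y = inner (sf_integral D s) y.
Proof.
move=> mD.
have ind i : integrable_on D (\1_(@sf_set _ _ s i) : R -> R).
  by apply: integrable_indic => //; [exact: sf_measurable|exact: sf_finite].
have [H1 H2] := integrable_on_sum (index_enum 'I_(sf_size s)) D
  (fun i t => inner (sf_val i) y * \1_(sf_set i) t) mD
  (fun i => integrable_onZ _ _ (inner (sf_val i) y) mD (ind i)).
under [X in integrable_on _ X]eq_fun do rewrite inner_sf_eval.
under eq_Rintegral do rewrite inner_sf_eval.
split=> //; rewrite H2 /sf_integral inner_suml; apply: eq_bigr => i _.
rewrite RintegralZl // Rintegral_indic //; last exact: sf_measurable.
by rewrite innerZl mulrC.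
Qed.

(** A scalar function that stays within [k] of the inner product of [f] with [y]
    has an integral within that of [k] of the inner product of the integral of
    [f] with [y]: both are compared with the simple functions approximating [f],
    and only scalar functions get integrated. *)
Lemma bochner_inner_approx D F k (f : R -> X) v y : measurable D ->
  integrable_on D F -> integrable_on D k ->
  (forall t, D t -> `|F t - inner (f t) y| <= k t) ->
  has_bochner_integral D f v ->
  `|\int[mu]_(t in D) F t - inner v y| <= \int[mu]_(t in D) k t.
Proof.
move=> mD Fi ki Fk [s [sm scvg sint]].
pose e n t := `|f t - sf_eval (s n) t|.
have [efin ecvg] : (\forall n \near \oo, integrable_on D (e n)) /\
    \int[mu]_(t in D) e n t @[n --> \oo] --> (0 : R).
  move/fine_cvgP : scvg => [fin cvg]; split=> //.
  apply: filterS fin => n fin; apply/integrableP; split.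
    by apply/measurable_EFinP; exact: sm.
  under eq_integral do rewrite /= normr_id.
  by move: fin; rewrite fin_num_abs => /(le_lt_trans _); apply; exact: lee_abs.
have icvg : `|\int[mu]_(t in D) F t - inner (sf_integral D (s n)) y| @[n --> \oo]
    --> `|\int[mu]_(t in D) F t - inner v y|.
  apply: cvg_norm; apply: cvgB; first exact: cvg_cst.
  by apply: cvg_inner sint _; exact: cvg_cst.
have bcvg : \int[mu]_(t in D) k t + `|y| * \int[mu]_(t in D) e n t @[n --> \oo]
    --> \int[mu]_(t in D) k t.
  rewrite -[X in _ --> X]addr0; apply: cvgD; first exact: cvg_cst.
  by rewrite -[X in _ --> X](mulr0 `|y|); apply: cvgMr.
apply: ler_cvg_to icvg bcvg _.
apply: filterS efin => n en.
have [si <-] := Rintegral_inner_sf_eval D (s n) y mD.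
rewrite -RintegralB // -RintegralZl // -RintegralD //; last exact: integrable_onZ.
apply: le_abs_Rintegral => //.
- exact: integrable_onB.
- by apply: integrable_onD => //; exact: integrable_onZ.
move=> t Dt.
have -> : F t - inner (sf_eval (s n) t) y =
    (F t - inner (f t) y) + inner (f t - sf_eval (s n) t) y.
  by rewrite innerBl; ring.
apply: (le_trans (ler_normD _ _)); apply: lerD; first exact: Fk.
by rewrite mulrC; exact: cauchy_schwarz.
Qed.

Lemma integrable_segment (a b : R) F : {within `[a, b], continuous F} ->
  integrable_on `[a, b] F.
Proof. by move=> cF; apply: continuous_compact_integrable => //; exact: segment_compact. Qed.

Lemma integrable_onM_bounded D (phi G : R -> R) : measurable D ->
  measurable_fun D phi -> (forall t, `|phi t| <= 1) -> integrable_on D G ->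
  integrable_on D (fun t => phi t * G t).
Proof.
move=> mD mphi phi1 GI; apply: le_integrable (GI) => //.
  apply/measurable_EFinP; apply: measurable_funM => //.
  by apply/measurable_EFinP; have /integrableP[] := GI.
by move=> t _; rewrite lee_fin normrM -[leRHS]mul1r ler_wpM2r.
Qed.

Lemma test_function_measurable (T : R) D (phi : R -> R) :
  test_function T phi -> measurable D -> measurable_fun D phi.
Proof.
move=> [dphi _ _] mD.
apply: measurable_funTS; apply: continuous_measurable_fun => t.
by apply: differentiable_continuous; apply/derivable1_diffP.
Qed.

Section weak_derivative_test.
Context (T : R) (u g : R -> X).
Hypothesis u_cont : {within `[0, T], continuous u}.
Hypothesis ug : weak_derivative T u g.

Lemma cont_sub (a b : R) : 0 <= a -> b <= T -> {within `[a, b], continuous u}.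
Proof.
move=> a0 bT; apply: continuous_subspaceW u_cont.
by apply: subset_itvScc; rewrite bnd_simp.
Qed.

Lemma cont_inner (a b : R) y : 0 <= a -> b <= T ->
  {within `[a, b], continuous (fun t => inner (u t) y)}.
Proof.
move=> a0 bT t; apply: cvg_inner; first exact: (cont_sub _ _ a0 bT).
exact: cvg_cst.
Qed.

(** Inner products turn the weak derivative into a scalar identity up to the
    error made in replacing [g] by an approximating simple function. *)
Lemma weak_derivative_test (a b : R) (phi : R -> R) s y :
  0 < a -> a <= b -> b < T -> test_function T phi ->
  (forall t, ~ (a <= t <= b) -> phi t = 0 /\ derive1 phi t = 0) ->
  (forall t, `|phi t| <= 1) ->
  integrable_on `[a, b] (fun t => `|g t - sf_eval s t|) ->
  `|\int[mu]_(t in `[a, b]) (derive1 phi t * inner (u t) y) +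
    \int[mu]_(t in `[a, b]) (phi t * inner (sf_eval s t) y)|
  <= `|y| * \int[mu]_(t in `[a, b]) `|g t - sf_eval s t|.
Proof.
move=> a0 ab bT tphi off phi1 gi.
have [dphi cphi _] := tphi.
have [v uv gv] := ug phi tphi.
have PD : `[a, b] `<=` `]0, T[.
  move=> t; rewrite /= !in_itv /= => /andP[at_ tb].
  by rewrite (lt_le_trans a0 at_) (le_lt_trans tb bT).
have mI : measurable (`[a, b] : set R) by exact: measurable_itv.
have mD : measurable (`]0, T[ : set R) by exact: measurable_itv.
have offI t : `]0, T[%classic t -> ~ `[a, b]%classic t ->
    phi t = 0 /\ derive1 phi t = 0.
  by move=> _; rewrite /= in_itv /=; exact: off.
pose F1 t := derive1 phi t * inner (u t) y.
pose F2 t := phi t * inner (sf_eval s t) y.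
have F1I : integrable_on `[a, b] F1.
  apply: integrable_segment => t.
  apply: cvgM; first exact: (continuous_subspaceT cphi).
  exact: (cont_inner _ _ y (ltW a0) (ltW bT)).
have [sI _] := Rintegral_inner_sf_eval `[a, b] s y mI.
have F2I : integrable_on `[a, b] F2.
  apply: integrable_onM_bounded => //; exact: test_function_measurable tphi mI.
have F1D : integrable_on `]0, T[ F1.
  apply: (integrable_support _ `[a, b]) => // t Dt It.
  by rewrite /F1 (offI t Dt It).2 mul0r.
have F2D : integrable_on `]0, T[ F2.
  apply: (integrable_support _ `[a, b]) => // t Dt It.
  by rewrite /F2 (offI t Dt It).1 mul0r.
pose k t := \1_(`[a, b]%classic) t * (`|y| * `|g t - sf_eval s t|).
have kI : integrable_on `[a, b] (fun t => `|y| * `|g t - sf_eval s t|).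
  exact: integrable_onZ.
have kE t : `[a, b]%classic t -> k t = `|y| * `|g t - sf_eval s t|.
  by move=> It; rewrite /k indicE mem_set // mul1r.
have k0 t : `]0, T[%classic t -> ~ `[a, b]%classic t -> k t = 0.
  by move=> _ It; rewrite /k indicE memNset // mul0r.
have kI' : integrable_on `[a, b] k.
  by apply: eq_integrable kI => // t /set_mem It /=; rewrite kE.
have kD : integrable_on `]0, T[ k by apply: (integrable_support _ `[a, b]).
have zI : integrable_on `]0, T[ (cst 0) by exact: integrable0.
have h1 := bochner_inner_approx `]0, T[ F1 (cst 0) _ v y mD F1D zI _ uv.
have {}h1 : \int[mu]_(t in `]0, T[) F1 t = inner v y.
  apply/eqP; rewrite -subr_eq0 -normr_le0; apply: (le_trans (h1 _)).
    by move=> t _; rewrite /F1 innerZl subrr normr0.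
  by rewrite Rintegral_cst // mul0r.
have h2 := bochner_inner_approx `]0, T[ F2 k _ (- v) y mD F2D kD _ gv.
have {}h2 : `|\int[mu]_(t in `]0, T[) F2 t - inner (- v) y| <= \int[mu]_(t in `]0, T[) k t.
  apply: h2 => t Dt; have [It|It] := pselect (`[a, b]%classic t).
    rewrite kE // /F2 innerZl -mulrBr -innerBl normrM -[leRHS]mul1r.
    by apply: ler_pM => //; rewrite mulrC distrC cauchy_schwarz.
  by rewrite k0 // /F2 (offI t Dt It).1 scale0r inner0l mul0r subrr normr0.
move: h2; rewrite innerNl opprK -h1 addrC.
rewrite !(Rintegral_support `]0, T[ `[a, b]) //.
- rewrite (@eq_Rintegral _ _ _ mu `[a, b]%classic (fun t => `|y| * `|g t - sf_eval s t|) k).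
    by rewrite RintegralZl.
  by move=> t /set_mem It; rewrite kE.
- by move=> t Dt It; rewrite /F2 (offI t Dt It).1 mul0r.
- by move=> t Dt It; rewrite /F1 (offI t Dt It).2 mul0r.
Qed.

End weak_derivative_test.

End bochner_inner.

(** * Smooth cutoff functions *)

Section cutoff.
Context {R : realType}.
Local Notation mu := (@lebesgue_measure R).
Local Notation integrable_on D f := (mu.-integrable D (EFin \o f)).
Implicit Types (x t a b h c : R) (f : R -> R).

(** The quadratic error bound treats the breakpoints of a piecewise quadratic
    function like all other points. *)
Lemma is_derive_quadratic f x l c :
  (forall h, `|f (x + h) - f x - h * l| <= c * h ^+ 2) -> is_derive x 1 f l.
Proof.
move=> fc.
have H : h^-1 *: (f (h *: 1 + x) - f x) @[h --> 0^'] --> l.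
  apply/cvgrPdist_le => e e0; near=> h.
  have h0 : h != 0 by near: h; exact: nbhs_dnbhs_neq.
  have nh : 0 < `|h| by rewrite normr_gt0.
  have hs : `|h| < e / (`|c| + 1).
    near: h; apply: dnbhs0_lt; rewrite divr_gt0 // ltr_wpDl //.
  have he : `|h| * (`|c| + 1) < e by rewrite -ltr_pdivlMr // ltr_wpDl.
  rewrite /GRing.scale /= mulr1 [h + x]addrC distrC.
  have -> : h^-1 * (f (x + h) - f x) - l = h^-1 * (f (x + h) - f x - h * l).
    by field.
  rewrite normrM normfV ler_pdivrMl //; apply: (le_trans (fc h)).
  have -> : h ^+ 2 = `|h| ^+ 2 by rewrite real_normK ?num_real.
  have hc : c * `|h| <= e.
    by apply: ltW; apply: le_lt_trans he; rewrite mulrC ler_wpM2l // ler_wpDr // ler_norm.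
  by rewrite expr2 mulrCA ler_wpM2l.
by split; [apply/cvg_ex; exists l|exact: cvg_lim H].
Unshelve. all: by end_near. Qed.

(** Its square is continuously differentiable, and so are the cutoffs built from
    translates of that square. *)
Definition pospart x : R := (x + `|x|) / 2.

Lemma pospartP x : (0 <= x /\ pospart x = x) \/ (x <= 0 /\ pospart x = 0).
Proof.
rewrite /pospart; have [x0|x0] := ger0P x; [left|right].
  by split=> //; lra.
by rewrite subrr mul0r (ltW x0).
Qed.

Lemma pospart_sqr_quadratic x h :
  `|pospart (x + h) ^+ 2 - pospart x ^+ 2 - h * (2 * pospart x)| <= h ^+ 2.
Proof.
rewrite ler_norml; apply/andP.
by have [[? ->]|[? ->]] := pospartP (x + h); have [[? ->]|[? ->]] := pospartP x;
  split; nra.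
Qed.

(** A continuously differentiable passage from 0 (left of 0) to 1 (right of 1). *)
Definition step x : R := 2 * pospart x ^+ 2 - 4 * pospart (x - 2^-1) ^+ 2
  + 2 * pospart (x - 1) ^+ 2.

Definition dstep x : R := 4 * pospart x - 8 * pospart (x - 2^-1) + 4 * pospart (x - 1).

Lemma step_le0 x : x <= 0 -> step x = 0 /\ dstep x = 0.
Proof.
move=> x0; rewrite /step /dstep.
by have [[? ->]|[? ->]] := pospartP x; have [[? ->]|[? ->]] := pospartP (x - 2^-1);
  have [[? ->]|[? ->]] := pospartP (x - 1); split; nra.
Qed.

Lemma step_ge1 x : 1 <= x -> step x = 1 /\ dstep x = 0.
Proof.
move=> x0; rewrite /step /dstep.
by have [[? ->]|[? ->]] := pospartP x; have [[? ->]|[? ->]] := pospartP (x - 2^-1);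
  have [[? ->]|[? ->]] := pospartP (x - 1); split; nra.
Qed.

Lemma dstep_ge0 x : 0 <= dstep x.
Proof.
rewrite /dstep.
by have [[? ->]|[? ->]] := pospartP x; have [[? ->]|[? ->]] := pospartP (x - 2^-1);
  have [[? ->]|[? ->]] := pospartP (x - 1); lra.
Qed.

Lemma step_itv01 x : 0 <= step x <= 1.
Proof.
rewrite /step; apply/andP.
by have [[? ->]|[? ->]] := pospartP x; have [[? ->]|[? ->]] := pospartP (x - 2^-1);
  have [[? ->]|[? ->]] := pospartP (x - 1); split; nra.
Qed.

Lemma continuous_dstep : continuous dstep.
Proof.
have cp (d : R) : continuous (fun x => pospart (x - d)).
  move=> x; apply: cvgMl.
  have hx : y - d @[y --> x] --> x - d by apply: cvgB; [exact: cvg_id|exact: cvg_cst].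
  by apply: cvgD (hx) _; exact: cvg_norm.
move=> x; apply: cvgD; last by apply: cvgMr; exact: cp.
apply: cvgB; apply: cvgMr; last exact: cp.
rewrite (_ : pospart = fun x => pospart (x - 0)); first exact: (cp 0).
by apply/funext => y; rewrite subr0.
Qed.

Lemma is_derive_step_affine (a h t : R) : h != 0 ->
  is_derive t 1 (fun t => step ((t - a) / h)) (dstep ((t - a) / h) / h).
Proof.
move=> h0; apply: (@is_derive_quadratic _ _ _ (8 / h ^+ 2)) => k.
set x := (t - a) / h.
have -> : (t + k - a) / h = x + k / h by rewrite /x; field.
have q0 := pospart_sqr_quadratic x (k / h).
have q1 := pospart_sqr_quadratic (x - 2^-1) (k / h).
have q2 := pospart_sqr_quadratic (x - 1) (k / h).
have -> : k * (dstep x / h) = k / h * dstep x by field.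
have -> : 8 / h ^+ 2 * k ^+ 2 = 8 * (k / h) ^+ 2 by field.
rewrite /step /dstep [x + k / h - 2^-1]addrAC [x + k / h - 1]addrAC.
move: q0 q1 q2; rewrite !ler_norml => /andP[? ?] /andP[? ?] /andP[? ?].
by apply/andP; split; lra.
Qed.

Lemma continuous_dstep_affine (a h : R) : continuous (fun t => dstep ((t - a) / h) / h).
Proof.
move=> t; apply: cvgMl.
have ht : (z - a) / h @[z --> t] --> (t - a) / h.
  by apply: cvgMl; apply: cvgB; [exact: cvg_id|exact: cvg_cst].
by apply: cvg_comp (ht) _; exact: continuous_dstep.
Qed.

(** A nonnegative kernel of mass 1 averages [f] to a value close to [f c] when
    it only charges points where [f] is close to [f c]. *)
Lemma kernel_average (a b c w : R) (A dA f : R -> R) : a < b ->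
  (forall t, is_derive t 1 A (dA t)) -> continuous dA -> (forall t, 0 <= dA t) ->
  A a = 0 -> A b = 1 -> {within `[a, b], continuous f} ->
  (forall t, a <= t <= b -> dA t != 0 -> `|f t - c| <= w) ->
  integrable_on `[a, b] (fun t => dA t * f t) /\
  `|\int[mu]_(t in `[a, b]) (dA t * f t) - c| <= w.
Proof.
move=> ab dAP dAc dA0 Aa Ab fc fw.
have mI : measurable (`[a, b] : set R) by exact: measurable_itv.
have dAs : {within `[a, b], continuous dA} by exact: continuous_subspaceT.
have dAI := integrable_segment a b dA dAs.
have fI : integrable_on `[a, b] (fun t => dA t * f t).
  apply: integrable_segment => t; apply: cvgM; [exact: dAs|exact: fc].
split=> //.
have mass : \int[mu]_(t in `[a, b]) dA t = 1.
  rewrite /Rintegral (@continuous_FTC2 _ dA A) //; first by rewrite Aa Ab -EFinB subr0.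
    have cA t : A x @[x --> t] --> A t.
      by apply/differentiable_continuous/derivable1_diffP; have [] := dAP t.
    split; [by move=> t _; have [] := dAP t | |].
      by apply: cvg_at_right_filter; exact: cA.
    by apply: cvg_at_left_filter; exact: cA.
  by move=> t _; rewrite derive1E; have [_] := dAP t.
have -> : c = \int[mu]_(t in `[a, b]) (c * dA t) by rewrite RintegralZl // mass mulr1.
rewrite -RintegralB //; last exact: integrable_onZ.
rewrite -[leRHS]mulr1 -mass -RintegralZl //.
apply: le_abs_Rintegral => //; [|exact: integrable_onZ|].
  by apply: integrable_onB => //; exact: integrable_onZ.
move=> t; rewrite /= in_itv /= => tab.
have [->|d0] := eqVneq (dA t) 0; first by rewrite mul0r !mulr0 subrr normr0.
rewrite [c * _]mulrC -mulrBr normrM ger0_norm // mulrC ler_wpM2r // fw //.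
Qed.

End cutoff.

(** * Increments of a weakly differentiable curve *)

Section increments.
Context {R : realType} {X : hilbertType R}.
Local Notation mu := (@lebesgue_measure R).
Local Notation integrable_on D f := (mu.-integrable D (EFin \o f)).
Variables (T : R) (u g : R -> X).
Hypothesis u_cont : {within `[0, T], continuous u}.
Hypothesis ug : weak_derivative T u g.
Implicit Types (a b h t : R) (s : @simple_function R X) (y : X).

Lemma cutoff_test_function a b h : 0 < a -> a < b -> b < T -> 0 < h -> h <= b - a ->
  let A t := step ((t - a) / h) in let B t := step ((t - (b - h)) / h) in
  let dA t := dstep ((t - a) / h) / h in let dB t := dstep ((t - (b - h)) / h) / h in
  [/\ test_function T (fun t => A t - B t),
      forall t, derive1 (fun t => A t - B t) t = dA t - dB t
    & forall t, ~ (a <= t <= b) -> A t - B t = 0 /\ dA t - dB t = 0].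
Proof.
move=> a0 ab bT h0 hab A B dA dB.
have hn0 : h != 0 by rewrite gt_eqF.
have AP t : is_derive t 1 A (dA t) by exact: is_derive_step_affine.
have BP t : is_derive t 1 B (dB t) by exact: is_derive_step_affine.
have ABP t : is_derive t 1 (fun t => A t - B t) (dA t - dB t) by exact: is_deriveB.
have d1 t : derive1 (fun t => A t - B t) t = dA t - dB t.
  by rewrite derive1E; have [_] := ABP t.
have off t : ~ (a <= t <= b) -> A t - B t = 0 /\ dA t - dB t = 0.
  rewrite /A /B /dA /dB => /negP; rewrite negb_and -!ltNge => /orP[ta|bt].
    have [|-> ->] := step_le0 ((t - a) / h).
      by rewrite pmulr_lle0 ?invr_gt0 // subr_le0 ltW.
    have [|-> ->] := step_le0 ((t - (b - h)) / h); last by rewrite mul0r !subrr.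
    by rewrite pmulr_lle0 ?invr_gt0 // subr_le0; lra.
  have [|-> ->] := step_ge1 ((t - a) / h).
    by rewrite ler_pdivlMr // mul1r; lra.
  have [|-> ->] := step_ge1 ((t - (b - h)) / h); last by rewrite mul0r !subrr.
  by rewrite ler_pdivlMr // mul1r; lra.
split=> //; split.
- by move=> t; have [] := ABP t.
- rewrite (_ : derive1 _ = fun t => dA t - dB t); last by apply/funext.
  by move=> t; apply: cvgB; exact: continuous_dstep_affine.
- exists a, b; split=> // t; apply: contraNT => tab.
  by have [|-> //] := off t; exact/negP.
Qed.

Lemma cutoff_deficit (A B : R) (i j : bool) : 0 <= A <= 1 -> 0 <= B <= 1 ->
  (~~ i -> A = 1) -> (~~ j -> B = 0) -> `|1 - (A - B)| <= i%:R + j%:R.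
Proof.
move=> /andP[? ?] /andP[? ?] A1 B0; rewrite ler_norml; apply/andP.
by case: i A1 => [_|->//]; case: j B0 => [_|->//]; split; rewrite /=; lra.
Qed.

(** The cutoffs tend to the indicator function of [[a, b]] while their
    derivatives average [inner (u _) y] near [a] and near [b]. *)
Lemma weak_derivative_increment a b s y : 0 < a -> a < b -> b < T ->
  integrable_on `[a, b] (fun t => `|g t - sf_eval s t|) ->
  `|inner (u b - u a) y - \int[mu]_(t in `[a, b]) inner (sf_eval s t) y|
  <= `|y| * \int[mu]_(t in `[a, b]) `|g t - sf_eval s t|.
Proof.
move=> a0 ab bT gi.
have mI : measurable (`[a, b] : set R) by exact: measurable_itv.
pose f t := inner (u t) y.
have fc : {within `[a, b], continuous f} by apply: (cont_inner T u u_cont); exact: ltW.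
pose C := (\sum_(i < sf_size s) `|sf_val i|) * `|y|.
have C0 : 0 <= C by rewrite mulr_ge0 // sumr_ge0.
have sC t : `|inner (sf_eval s t) y| <= C.
  by apply: (le_trans (cauchy_schwarz _ _)); rewrite ler_wpM2r // norm_sf_eval_le.
have [_ fca fcb] := (continuous_within_itvP f ab).1 fc.
apply/ler_addgt0Pr => e' e'0.
pose e := e' / (2 + 2 * C).
have e0 : 0 < e by rewrite divr_gt0 // ltr_wpDr // mulr_ge0.
have [h1 h10 fa] : exists2 d, 0 < d & forall t, a <= t <= a + d -> `|f t - f a| <= e.
  move/cvgrPdist_le : fca => /(_ e e0) [d /= d0 H].
  exists (d / 2) => [|t /andP[]]; first by rewrite divr_gt0.
  rewrite le_eqVlt => /predU1P[<- _|at_ td]; first by rewrite subrr normr0 ltW.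
  rewrite distrC; apply: H => //; rewrite /= distrC gtr0_norm ?subr_gt0 //.
  by move: d0; lra.
have [h2 h20 fb] : exists2 d, 0 < d & forall t, b - d <= t <= b -> `|f t - f b| <= e.
  move/cvgrPdist_le : fcb => /(_ e e0) [d /= d0 H].
  exists (d / 2) => [|t /andP[td]]; first by rewrite divr_gt0.
  rewrite le_eqVlt => /predU1P[->|tb]; first by rewrite subrr normr0 ltW.
  rewrite distrC; apply: H => //; rewrite /= gtr0_norm ?subr_gt0 //.
  by move: d0; lra.
(* the width of the two transition zones of the cutoff *)
pose h := Num.min (Num.min h1 h2) (Num.min e (b - a)).
have h0 : 0 < h by rewrite !lt_min h10 h20 e0 subr_gt0.
have [hh1 hh2 he hab] : [/\ h <= h1, h <= h2, h <= e & h <= b - a].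
  by split; rewrite /h !ge_min lexx ?orbT.
have [tphi dphi offphi] := cutoff_test_function a b h a0 ab bT h0 hab.
set A := fun t => step ((t - a) / h) in tphi dphi offphi.
set B := fun t => step ((t - (b - h)) / h) in tphi dphi offphi.
set dA := fun t => dstep ((t - a) / h) / h in dphi offphi.
set dB := fun t => dstep ((t - (b - h)) / h) / h in dphi offphi.
have A01 t : 0 <= A t <= 1 by exact: step_itv01.
have B01 t : 0 <= B t <= 1 by exact: step_itv01.
have test := weak_derivative_test T u g u_cont ug a b _ s y a0 (ltW ab) bT tphi.
have phi1 t : `|A t - B t| <= 1.
  by move: (A01 t) (B01 t) => /andP[? ?] /andP[? ?]; rewrite ler_norml; apply/andP; split; lra.
have {}test : `|\int[mu]_(t in `[a, b]) (derive1 (fun t => A t - B t) t * f t) +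
    \int[mu]_(t in `[a, b]) ((A t - B t) * inner (sf_eval s t) y)|
    <= `|y| * \int[mu]_(t in `[a, b]) `|g t - sf_eval s t|.
  by apply: test => // t /offphi[-> dAB]; rewrite dphi.
have hn0 : h != 0 by rewrite gt_eqF.
have [dAf avgA] : integrable_on `[a, b] (fun t => dA t * f t) /\
    `|\int[mu]_(t in `[a, b]) (dA t * f t) - f a| <= e.
  apply: (@kernel_average _ a b (f a) e A dA f ab).
  - by move=> t; exact: is_derive_step_affine.
  - exact: continuous_dstep_affine.
  - by move=> t; rewrite /dA divr_ge0 ?dstep_ge0 // ltW.
  - by rewrite /A; have [|] := step_le0 ((a - a) / h); rewrite // subrr mul0r.
  - by rewrite /A; have [|] := step_ge1 ((b - a) / h); rewrite // ler_pdivlMr // mul1r.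
  - exact: fc.
  - move=> t /andP[at_ tb] dn0; apply: fa; rewrite at_ /= leNgt; apply/negP => ht.
    move/negP: dn0; apply; rewrite /dA; have [|_ ->] := step_ge1 ((t - a) / h).
      by rewrite ler_pdivlMr // mul1r; lra.
    by rewrite mul0r.
have [dBf avgB] : integrable_on `[a, b] (fun t => dB t * f t) /\
    `|\int[mu]_(t in `[a, b]) (dB t * f t) - f b| <= e.
  apply: (@kernel_average _ a b (f b) e B dB f ab).
  - by move=> t; exact: is_derive_step_affine.
  - exact: continuous_dstep_affine.
  - by move=> t; rewrite /dB divr_ge0 ?dstep_ge0 // ltW.
  - rewrite /B; have [|//] := step_le0 ((a - (b - h)) / h).
    by rewrite pmulr_lle0 ?invr_gt0 //; lra.
  - rewrite /B; have [|//] := step_ge1 ((b - (b - h)) / h).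
    by rewrite ler_pdivlMr // mul1r; lra.
  - exact: fc.
  - move=> t /andP[at_ tb] dn0; apply: fb; rewrite tb andbT leNgt; apply/negP => ht.
    move/negP: dn0; apply; rewrite /dB; have [|_ ->] := step_le0 ((t - (b - h)) / h).
      by rewrite pmulr_lle0 ?invr_gt0 //; lra.
    by rewrite mul0r.
have dphif : \int[mu]_(t in `[a, b]) (derive1 (fun t => A t - B t) t * f t) =
    \int[mu]_(t in `[a, b]) (dA t * f t) - \int[mu]_(t in `[a, b]) (dB t * f t).
  rewrite -RintegralB //.
  by apply: eq_Rintegral => t _; rewrite dphi mulrBl.
have [sI _] := Rintegral_inner_sf_eval `[a, b] s y mI.
have phisI : integrable_on `[a, b] (fun t => (A t - B t) * inner (sf_eval s t) y).
  by apply: integrable_onM_bounded => //; exact: test_function_measurable tphi mI.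
pose Ia t : R := \1_(`[a, a + h]%classic) t.
pose Ib t : R := \1_(`[b - h, b]%classic) t.
have fin_mu (p q : R) : p <= q -> (mu (`[p, q]%classic) < +oo)%E.
  by move=> pq; rewrite lebesgue_measure_itv /=; case: ifP => _; rewrite ?ltry.
have IaI : integrable_on `[a, b] Ia.
  by apply: integrable_indic; rewrite ?fin_mu ?lerDl ?(ltW h0) //; exact: measurable_itv.
have IbI : integrable_on `[a, b] Ib.
  by apply: integrable_indic; rewrite ?fin_mu ?gerBl ?(ltW h0) //; exact: measurable_itv.
have edge : `|\int[mu]_(t in `[a, b]) inner (sf_eval s t) y -
    \int[mu]_(t in `[a, b]) ((A t - B t) * inner (sf_eval s t) y)| <= 2 * C * e.
  rewrite -RintegralB //.
  apply: (@le_trans _ _ (\int[mu]_(t in `[a, b]) (C * (Ia t + Ib t)))).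
    apply: le_abs_Rintegral => //; first exact: integrable_onB.
      by apply: integrable_onZ => //; exact: integrable_onD.
    move=> t; rewrite /= in_itv /= => /andP[at_ tb].
    rewrite -{1}[inner _ _]mul1r -mulrBl normrM mulrC.
    apply: ler_pM => //.
    have A1 : ~~ (t <= a + h) -> A t = 1.
      rewrite -ltNge => ht; have [|//] := step_ge1 ((t - a) / h).
      by rewrite ler_pdivlMr // mul1r; lra.
    have B0 : ~~ (b - h <= t) -> B t = 0.
      rewrite -ltNge => ht; have [|//] := step_le0 ((t - (b - h)) / h).
      by rewrite pmulr_lle0 ?invr_gt0 //; lra.
    rewrite /Ia /Ib !indicE !mem_setE !in_itv /= at_ tb andbT /=.
    exact: cutoff_deficit (A01 t) (B01 t) A1 B0.
  rewrite RintegralZl //; last exact: integrable_onD.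
  rewrite RintegralD // -[leRHS]mulrA [leRHS]mulrCA ler_wpM2l //.
  have := Rintegral_indic_itv_le `[a, b] a (a + h) mI.
  have := Rintegral_indic_itv_le `[a, b] (b - h) b mI.
  rewrite lerDl gerBl (ltW h0) => /(_ isT) + /(_ isT).
  by rewrite /Ia /Ib; lra.
rewrite dphif in test.
have e'E : e' = 2 * e + 2 * C * e.
  by rewrite -mulrDl mulrC /e mulfVK // gt_eqF // ltr_wpDr // mulr_ge0.
rewrite e'E innerBl -/(f b) -/(f a).
move: test avgA avgB edge; rewrite !ler_norml.
move=> /andP[? ?] /andP[? ?] /andP[? ?] /andP[? ?].
by apply/andP; split; lra.
Qed.

End increments.

(** * Growth of the distance between a curve and a segment *)

Section energy.
Context {R : realType} {X : hilbertType R}.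
Local Notation mu := (@lebesgue_measure R).
Local Notation integrable_on D f := (mu.-integrable D (EFin \o f)).
Implicit Types (a b c r t x : R).

(** The supremum of the points that [a] reaches is reached, and only [b] can be
    that supremum. *)
Lemma local_to_global (P : R -> R -> Prop) a b : a <= b ->
  (forall r x t, a <= r -> r <= x -> x <= t -> t <= b -> P r x -> P x t -> P r t) ->
  (forall x, a <= x <= b -> exists2 d, 0 < d & forall r t, a <= r -> r <= t -> t <= b ->
     `|r - x| < d -> `|t - x| < d -> P r t) ->
  P a b.
Proof.
move=> ab Ptrans Ploc.
pose S := [set t | a <= t <= b /\ P a t].
have Sa : S a.
  split; first by rewrite lexx.
  have [|d d0 H] := Ploc a; first by rewrite lexx.
  by apply: H; rewrite // subrr normr0.
have Sub : has_sup S by split; [exists a|exists b => t [/andP[]]].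
pose z := sup S.
have az : a <= z by apply: ub_le_sup => //; have [] := Sub.
have zb : z <= b by apply: ge_sup; [exists a|move=> t [/andP[]]].
have [|d d0 H] := Ploc z; first by rewrite az.
have [t [tab Pat] tz] : exists2 t, S t & z - d < t by exact: sup_adherent.
have /andP[at_ tb] := tab.
have tlez : t <= z by apply: ub_le_sup; [have [] := Sub|].
have [bz|zltb] := leP b (z + d / 2).
  apply: (Ptrans _ t) => //; apply: H => //.
    by rewrite ler0_norm ?subr_le0 //; lra.
  by rewrite ger0_norm ?subr_ge0 //; lra.
have : S (z + d / 2).
  have ge_z : t <= z + d / 2 by lra.
  split; first by apply/andP; split; lra.
  apply: (Ptrans _ t) => //; [lra| apply: H => //; [lra| |]].
    by rewrite ler0_norm ?subr_le0 //; lra.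
  by rewrite addrAC subrr add0r gtr0_norm; lra.
have [_ ub] := Sub.
by move=> /(ub_le_sup ub); rewrite -/z; lra.
Qed.

Lemma Rintegral_itv_split (f : R -> R) a b x : a <= x -> x <= b ->
  integrable_on `[a, b] f ->
  \int[mu]_(t in `[a, b]) f t =
  \int[mu]_(t in `[a, x]) f t + \int[mu]_(t in `[x, b]) f t.
Proof.
move=> ax xb fi.
have mI (p q : R) : measurable (`[p, q] : set R) by exact: measurable_itv.
have := @Rintegral_itvB R f (BLeft a) (BRight b) x fi.
rewrite !bnd_simp ax xb => /(_ isT isT) /eqP; rewrite subr_eq addrC => /eqP ->.
congr (_ + _); rewrite Rintegral_itv_obnd_cbnd //.
apply: integrable_onS fi => //.
by apply: subset_itv; rewrite bnd_simp.
Qed.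

Lemma L1loc_approx (T a e : R) (g : R -> X) : 0 < a < T -> 0 < e -> L1loc T g ->
  exists s : @simple_function R X,
    integrable_on `[a, T] (fun t => `|g t - sf_eval s t|) /\
    \int[mu]_(t in `[a, T]) `|g t - sf_eval s t| <= e.
Proof.
move=> aT e0 /(_ a aT)[v [s [sm scvg _]]].
move/fine_cvgP : scvg => [fin cvg].
have [n [finn en]] : exists n, (\int[mu]_(t in `[a, T]) (`|g t - sf_eval (s n) t|)%:E)%E
    \is a fin_num /\ \int[mu]_(t in `[a, T]) `|g t - sf_eval (s n) t| <= e.
  apply: filter_ex (filterI fin _).
  by apply: (cvgr_le _ cvg).
exists (s n); split=> //; apply/integrableP; split.
  by apply/measurable_EFinP; exact: sm.
under eq_integral do rewrite /= normr_id.
by move: finn; rewrite fin_num_abs => /(le_lt_trans _); apply; exact: lee_abs.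
Qed.

Variables (T : R) (u g v : R -> X) (q : X).
Hypothesis u_cont : {within `[0, T], continuous u}.
Hypothesis ug : W11loc T u g.
Hypothesis v_affine : forall r t, v t - v r = (t - r) *: q.
Let w t := u t - v t.

Lemma v_continuous : continuous v.
Proof.
move=> t.
have vE x : v x = v t + (x - t) *: q by rewrite -v_affine addrC subrK.
have h : v t + (x - t) *: q @[x --> t] --> v t + (t - t) *: q.
  apply: cvgD; first exact: cvg_cst.
  by apply: cvgZr_tmp; apply: cvgB; [exact: cvg_id|exact: cvg_cst].
by rewrite -vE (_ : (fun x => _) = v) in h => //; apply/funext => x; rewrite [RHS]vE.
Qed.

Lemma w_cont a b : 0 <= a -> b <= T -> {within `[a, b], continuous w}.
Proof.
move=> a0 bT t; apply: cvgB; first exact: (cont_sub T u u_cont).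
exact: (continuous_subspaceT v_continuous).
Qed.

(** On an interval where [w] varies by at most [o], the increment of
    [`|w t| ^+ 2] is the inner product of that of [w] with [w r + w t], in which
    [w r + w t] may be replaced by [2 *: w x] under the integral. *)
Lemma energy_increment a b c M C o (s : @simple_function R X) :
  0 < a -> a < b -> b < T -> 0 <= o ->
  integrable_on `[a, b] (fun t => `|g t - sf_eval s t|) ->
  (forall t, `|sf_eval s t| <= C) ->
  (forall t, a <= t <= b -> `|w t| <= M) ->
  (forall x y, a <= x <= b -> a <= y <= b -> `|w x - w y| <= o) ->
  {ae mu, forall t, a <= t <= b -> inner (g t - q) (w t) <= c} ->
  `|w b| ^+ 2 - `|w a| ^+ 2 <= (2 * c + 2 * o * (C + `|q|)) * (b - a)
    + (4 * M + 2 * o) * \int[mu]_(t in `[a, b]) `|g t - sf_eval s t|.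
Proof.
move=> a0 ab bT o0 ei sC wM wo wc.
have mI : measurable (`[a, b] : set R) by exact: measurable_itv.
pose e t := `|g t - sf_eval s t|.
pose y := w b + w a.
have aI : a <= a <= b by rewrite lexx ltW.
have bI : a <= b <= b by rewrite lexx ltW.
have M0 : 0 <= M by exact: le_trans (wM _ aI).
have yM : `|y| <= 2 * M.
  by apply: (le_trans (ler_normD _ _)); have := wM _ aI; have := wM _ bI; lra.
have sq : `|w b| ^+ 2 - `|w a| ^+ 2 = inner (w b - w a) y.
  rewrite /y; move: (w a) (w b) => p1 p2.
  by rewrite -!inner_norm !innerE (innerC p1 p2); ring.
have [_ _ wug] := ug.
have incr := weak_derivative_increment T u g u_cont wug a b s y a0 ab bT ei.
have [sI _] := Rintegral_inner_sf_eval `[a, b] s y mI.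
have cst_int (r : R) : \int[mu]_(t in `[a, b]) r = r * (b - a).
  rewrite Rintegral_cst //; congr (_ * _).
  transitivity (fine (mu (`[a, b]%classic))) => //.
  by rewrite lebesgue_measure_itv /= lte_fin ab.
have cstI (r : R) : integrable_on `[a, b] (cst r) by apply: integrable_segment => t; exact: cvg_cst.
have main : \int[mu]_(t in `[a, b]) (inner (sf_eval s t) y - inner q y) <=
    \int[mu]_(t in `[a, b]) (2 * c + 2 * o * (C + `|q|) + (2 * M + 2 * o) * e t).
  apply: ae_le_Rintegral => //.
  - by apply: integrable_onB => //; exact: cstI.
  - by apply: integrable_onD => //; [exact: cstI|exact: integrable_onZ].
  apply: ae_imply wc => x wc; rewrite /= in_itv /= => xI.
  have {}wc := wc xI.
  have -> : inner (sf_eval s x) y - inner q y = inner (sf_eval s x - g x) y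
      + 2 * inner (g x - q) (w x) + inner (g x - q) (y - 2 *: w x).
    by move: (w x) => p1; rewrite !innerE; ring.
  have h1 : inner (sf_eval s x - g x) y <= e x * (2 * M).
    by apply: (le_trans (inner_le _ _)); rewrite distrC ler_wpM2l.
  have h2 : inner (g x - q) (y - 2 *: w x) <= (e x + (C + `|q|)) * (2 * o).
    apply: (le_trans (inner_le _ _)); apply: ler_pM => //.
      rewrite addrA (_ : g x - q = (g x - sf_eval s x) + sf_eval s x - q); last by rewrite subrK.
      apply: (le_trans (ler_normB _ _)); rewrite lerD2r.
      by apply: (le_trans (ler_normD _ _)); rewrite lerD2l.
    rewrite (_ : y - 2 *: w x = (w b - w x) + (w a - w x)); last first.
      by rewrite scaler_nat mulr2n opprD addrACA.
    apply: (le_trans (ler_normD _ _)).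
    by have := wo _ _ bI xI; have := wo _ _ aI xI; lra.
  by move: h1 h2 wc; lra.
move: main; rewrite RintegralB ?cst_int //; last exact: cstI.
rewrite RintegralD //; [|exact: cstI|exact: integrable_onZ].
rewrite cst_int RintegralZl // sq => main.
have -> : inner (w b - w a) y = inner (u b - u a) y - inner q y * (b - a).
  rewrite mulrC -innerZl -v_affine -innerBl; congr (inner _ y).
  by rewrite /w opprD addrACA -opprD.
have : `|y| * \int[mu]_(t in `[a, b]) e t <= 2 * M * \int[mu]_(t in `[a, b]) e t.
  apply: ler_wpM2r yM; apply: Rintegral_ge0 => t _; exact: normr_ge0.
by move: incr main; rewrite ler_norml => /andP[_]; rewrite -/(e _); lra.
Qed.

(** A simple function close to [g] in mean is fixed first; the intervals can then
    be taken so short that the oscillation of [w] on them is small compared with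
    the size of that simple function. *)
Lemma energy_estimate a b c : 0 < a -> a < b -> b < T ->
  {ae mu, forall t, a <= t <= b -> inner (g t - q) (w t) <= c} ->
  `|w b| ^+ 2 - `|w a| ^+ 2 <= 2 * c * (b - a).
Proof.
move=> a0 ab bT wc.
have aT : a < T by exact: lt_trans bT.
have [M M0 wM] : exists2 M, 0 <= M & forall t, a <= t <= b -> `|w t| <= M.
  have nw : {within `[a, b], continuous (fun t => `|w t|)}.
    by move=> t; apply: cvg_norm; exact: (w_cont _ _ (ltW a0) (ltW bT)).
  have [m _ mmax] := EVT_max (ltW ab) nw.
  exists `|w m| => // t tab; exact: mmax.
have T0 : 0 < T by exact: lt_trans a0 aT.
have [uc _ _] := (continuous_within_itvP u T0).1 u_cont.
apply/ler_addgt0Pr => e e0.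
have [_ gL1 _] := ug.
(* tolerances for the two error terms of [energy_increment], each contributing at
   most [e / 2] *)
pose n1 := e / (2 * (4 * M + 2)).
have M2 : 0 < 4 * M + 2 by lra.
have n10 : 0 < n1 by rewrite divr_gt0 // mulr_gt0.
have [|s [sT se]] := L1loc_approx T a n1 g _ n10 gL1; first by rewrite a0.
pose C := \sum_(i < sf_size s) `|sf_val i|.
have sC t : `|sf_eval s t| <= C by exact: norm_sf_eval_le.
have C0 : 0 <= C by rewrite sumr_ge0.
pose K := 2 * (C + `|q|) * (b - a).
have K0 : 0 <= K.
  by apply: mulr_ge0; [rewrite mulr_ge0 // addr_ge0|rewrite subr_ge0 ltW].
pose o := Num.min 1 (e / (2 * (K + 1))).
have o0 : 0 < o by rewrite lt_min ltr01 divr_gt0 // mulr_gt0 // ltr_wpDl.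
have o1 : o <= 1 by rewrite ge_min lexx.
have oK : o * K <= e / 2.
  have : o <= e / (2 * (K + 1)) by rewrite ge_min lexx orbT.
  by rewrite ler_pdivlMr ?mulr_gt0 ?ltr_wpDl //; nra.
pose err t := `|g t - sf_eval s t|.
have mI (p r : R) : measurable (`[p, r] : set R) by exact: measurable_itv.
have sub (p r : R) : a <= p -> r <= T -> `[p, r]%classic `<=` `[a, T]%classic.
  by move=> ap rT; apply: subset_itv; rewrite bnd_simp.
have errI (p r : R) : a <= p -> r <= T -> integrable_on `[p, r] err.
  by move=> ap rT; apply: integrable_onS sT => //; exact: sub.
have err_ge0 (p r : R) : 0 <= \int[mu]_(t in `[p, r]) err t.
  by apply: Rintegral_ge0 => t _; exact: normr_ge0.
have errb : \int[mu]_(t in `[a, b]) err t <= n1.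
  have := Rintegral_itv_split err a T b (ltW ab) (ltW bT) sT.
  move=> eq; apply: le_trans se; rewrite eq; have := err_ge0 b T.
  by rewrite lerDl.
pose c1 := 2 * c + 2 * o * (C + `|q|).
pose c2 := 4 * M + 2 * o.
have c20 : 0 <= c2 by rewrite addr_ge0 // mulr_ge0 // ltW.
have : `|w b| ^+ 2 - `|w a| ^+ 2 <= c1 * (b - a) + c2 * \int[mu]_(t in `[a, b]) err t.
  apply: (local_to_global (fun r t => `|w t| ^+ 2 - `|w r| ^+ 2 <=
    c1 * (t - r) + c2 * \int[mu]_(x in `[r, t]) err x)) => //; first exact: ltW.
    move=> r x t ar rx xt tb.
    rewrite (Rintegral_itv_split err r t x) //; last first.
      by apply: errI => //; exact: le_trans tb (ltW bT).
    by lra.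
  move=> x /andP[ax xb].
  have wx : w z @[z --> x] --> w x.
    apply: cvgB; last exact: v_continuous.
    by apply: uc; rewrite in_itv /= (lt_le_trans a0 ax) (le_lt_trans xb bT).
  move/cvgrPdist_le : wx => /(_ (o / 2)); rewrite divr_gt0 // => /(_ isT)[d /= d0 wd].
  exists d => // r t ar rt tb rx tx.
  have [->|rnt] := eqVneq r t.
    by rewrite !subrr mulr0 add0r mulr_ge0.
  have near z : r <= z <= t -> `|w x - w z| <= o / 2.
    move=> /andP[rz zt]; apply: wd => /=.
    move: rx tx; rewrite !ltr_norml => /andP[? ?] /andP[? ?].
    by apply/andP; split; lra.
  apply: energy_increment => //.
  - exact: lt_le_trans ar.
  - by rewrite lt_neqAle rnt.
  - exact: le_lt_trans bT.
  - exact: ltW.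
  - by apply: errI => //; exact: le_trans tb (ltW bT).
  - by move=> z /andP[rz zt]; apply: wM; rewrite (le_trans ar rz) (le_trans zt tb).
  - move=> z z' zI z'I; rewrite (_ : w z - w z' = (w x - w z') - (w x - w z)).
      by apply: (le_trans (ler_normB _ _)); have := near _ zI; have := near _ z'I; lra.
    move: (w z) (w z') (w x) => p1 p2 p3.
    by rewrite opprB [RHS]addrC addrA subrK.
  - apply: ae_imply wc => z wc /andP[rz zt]; apply: wc.
    by rewrite (le_trans ar rz) (le_trans zt tb).
have e1 : c2 * \int[mu]_(t in `[a, b]) err t <= e / 2.
  have n1E : (4 * M + 2) * n1 = e / 2 by rewrite /n1; field; rewrite gt_eqF.
  rewrite -n1E; apply: ler_pM => //.
  by rewrite /c2; lra.
have e2 : c1 * (b - a) = 2 * c * (b - a) + o * K by rewrite /c1 /K; ring.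
by rewrite e2; lra.
Qed.

(** Continuity extends the estimate to [a = 0], an endpoint near which the
    derivative of [u] may fail to be integrable. *)
Lemma energy_estimate_closed a b c : 0 <= a -> a < b -> b < T ->
  {ae mu, forall t, a < t <= b -> inner (g t - q) (w t) <= c} ->
  `|w b| ^+ 2 - `|w a| ^+ 2 <= 2 * c * (b - a).
Proof.
move=> a0 ab bT wc.
have [_ wa _] := (continuous_within_itvP w ab).1 (w_cont a b a0 (ltW bT)).
have lhs : `|w b| ^+ 2 - `|w x| ^+ 2 @[x --> a^'+] --> `|w b| ^+ 2 - `|w a| ^+ 2.
  apply: cvgB; first exact: cvg_cst.
  by rewrite !expr2; apply: cvgM; apply: cvg_norm.
have rhs : 2 * c * (b - x) @[x --> a^'+] --> 2 * c * (b - a).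
  apply: cvgMr; apply: cvgB; first exact: cvg_cst.
  by apply: cvg_at_right_filter; exact: cvg_id.
apply: ler_cvg_to lhs rhs _; near=> x.
have ax : a < x by near: x; exact: nbhs_right_gt.
have xb : x < b by near: x; exact: nbhs_right_lt.
apply: energy_estimate => //; first exact: le_lt_trans ax.
apply: ae_imply wc => t wc /andP[xt tb]; apply: wc.
  by rewrite (lt_le_trans ax xt).
Unshelve. all: by end_near. Qed.

End energy.

(** * A priori error of the implicit Euler scheme *)

Section euler_scheme.
Context {R : realType} {X : hilbertType R}.
Local Notation mu := (@lebesgue_measure R).
Implicit Types (E : X -> \bar R) (x p : X) (l t T : R) (k n : nat).

(** Any selection will do: existence comes from convexity and lower
    semicontinuity, and all estimates follow from the subgradient inequality. *)
Definition resolvent E l x : X :=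
  xget x [set j | subdifferential E j (l^-1 *: (x - j))].

Lemma resolventP E l x : convex_lsc E -> (exists y, dom E y) -> 0 < l ->
  subdifferential E (resolvent E l x) (l^-1 *: (x - resolvent E l x)).
Proof.
by move=> cE dE l0; exact: (xgetPex x (resolvent_exists E l x cE dE l0)).
Qed.

Definition implicit_euler E l p k : X := iter k (resolvent E l) p.

Section error.
Context (E : X -> \bar R) (l T : R) (u0 : X) (u : R -> X).
Hypothesis E_cl : convex_lsc E.
Hypothesis l0 : 0 < l.
Hypothesis u_flow : flow_solution E T u0 u.

Lemma dom_fineK x : dom E x -> E x = (fine (E x))%:E.
Proof. by have [E0 _ _] := E_cl; move=> d; rewrite fineK // dom_fin_num. Qed.

Lemma fine_energy_ge0 x : 0 <= fine (E x).
Proof. by have [E0 _ _] := E_cl; rewrite fine_ge0. Qed.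

Lemma resolvent_decay p : dom E p ->
  dom E (resolvent E l p) /\
  fine (E (resolvent E l p)) + l^-1 * `|p - resolvent E l p| ^+ 2 <= fine (E p).
Proof.
move=> dp; have [dj H] := resolventP E l p E_cl (ex_intro _ p dp) l0.
split=> //; have := H p; rewrite (dom_fineK _ dj) (dom_fineK _ dp) -EFinD lee_fin.
by rewrite innerZl inner_norm.
Qed.

(** The segment from [p] to its resolvent is traversed in the direction opposite to
    a subgradient at its endpoint. Adding the subgradient inequality of the flow,
    tested with the point of the segment, to the one at the endpoint, tested with
    the flow, cancels the energy of the flow; by convexity along the segment, half
    the squared distance grows at a rate at most the drop of energy from [p] to its
    resolvent. *)
Lemma euler_step p a t : dom E p -> 0 <= a -> a + l < T -> a <= t <= a + l ->
  `|u t - (p + (t - a) *: (l^-1 *: (resolvent E l p - p)))| ^+ 2 <=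
  `|u a - p| ^+ 2 + 2 * (fine (E p) - fine (E (resolvent E l p))) * (t - a).
Proof.
move=> dp a0 alT /andP[at_ tal].
set j := resolvent E l p.
have [dj decay] := resolvent_decay p dp; rewrite -/j in dj decay.
have [_ jsub] := resolventP E l p E_cl (ex_intro _ p dp) l0.
rewrite -/j in jsub.
set q := l^-1 *: (j - p).
pose v r := p + (r - a) *: q.
have [->|ta] := eqVneq t a; first by rewrite subrr scale0r addr0 mulr0 addr0.
have [u_cont _ [g ug ae_g]] := u_flow.
have v_aff r s : v s - v r = (s - r) *: q.
  by rewrite /v opprD addrACA subrr add0r -scalerBl opprB addrA subrK.
have va : v a = p by rewrite /v subrr scale0r addr0.
have [_ cvx _] := E_cl.
pose c := fine (E p) - fine (E j).
have c0 : 0 <= c.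
  rewrite subr_ge0; apply: le_trans decay; rewrite lerDl.
  by rewrite mulr_ge0 ?sqr_ge0 // invr_ge0 ltW.
have ltat : a < t by rewrite lt_neqAle eq_sym ta.
suff : `|u t - v t| ^+ 2 - `|u a - v a| ^+ 2 <= 2 * c * (t - a).
  by rewrite va lerBlDl.
apply: (energy_estimate_closed T u g v q u_cont ug v_aff) => //.
  exact: le_lt_trans alT.
apply: ae_imply ae_g => r gr /andP[ar rt].
have [|dr rsub] := gr; first by rewrite in_itv /= (le_lt_trans a0 ar) (le_lt_trans (le_trans rt tal)).
(* [v r] is the convex combination of [j] and [p] with weight [th] *)
pose th := (r - a) / l.
have th01 : 0 <= th <= 1.
  rewrite divr_ge0 ?subr_ge0 ?(ltW ar) ?(ltW l0) //= ler_pdivrMr // mul1r.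
  by rewrite lerBlDl (le_trans rt).
have vE : v r = th *: j + (1 - th) *: p.
  rewrite /v /q /th scalerA scalerBr scalerBl scale1r.
  by rewrite addrCA.
have := cvx th j p th01; rewrite -vE (dom_fineK _ dj) (dom_fineK _ dp) -!EFinM -EFinD => Ev.
have dv : dom E (v r) by apply: le_lt_trans Ev (ltry _).
move: Ev; rewrite (dom_fineK _ dv) lee_fin => Ev.
have := rsub (v r); rewrite (dom_fineK _ dr) (dom_fineK _ dv) -EFinD lee_fin => h1.
have := jsub (u r); rewrite (dom_fineK _ dr) (dom_fineK _ dj) -EFinD lee_fin => h2.
have h3 : inner (- q) (j - v r) <= 0.
  have -> : j - v r = (1 - th) *: (j - p).
    by rewrite vE opprD addrA -{1}[j]scale1r -scalerBl -scalerBr.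
  rewrite /q innerNl innerZl innerZr inner_norm oppr_le0.
  rewrite mulr_ge0 ?invr_ge0 ?(ltW l0) // mulr_ge0 ?sqr_ge0 //.
  by rewrite subr_ge0; have /andP[] := th01.
have qE : l^-1 *: (p - j) = - q by rewrite /q -scalerN opprB.
have thc : th * c >= 0 by rewrite mulr_ge0 //; have /andP[] := th01.
have cE : c = fine (E p) - fine (E j) by [].
have -> : inner (g r - q) (u r - v r) =
    inner (- g r) (v r - u r) + inner (- q) (u r - j) + inner (- q) (j - v r).
  by rewrite !innerE; ring.
rewrite qE in h2; move: thc; rewrite cE; move: h1 h2 h3 Ev; lra.
Qed.

Lemma implicit_euler_dom p k : dom E p -> dom E (implicit_euler E l p k).
Proof.
by move=> dp; elim: k => [//|k IH]; have [] := resolvent_decay _ IH.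
Qed.

(** Telescoping the one-step bounds, the energy dissipated by the scheme pays for
    the error. *)
Lemma implicit_euler_error_nodes p k : dom E p -> k%:R * l < T ->
  `|u (k%:R * l) - implicit_euler E l p k| ^+ 2 + 2 * l * fine (E (implicit_euler E l p k))
  <= `|u0 - p| ^+ 2 + 2 * l * fine (E p).
Proof.
move=> dp; elim: k => [|k IH] kT.
  by have [_ -> _] : [/\ True, u (0 * l) = u0 & True]; [rewrite mul0r; have [_ -> _] := u_flow|].
have kE : k.+1%:R * l = k%:R * l + l by rewrite -natr1 mulrDl mul1r.
have kl0 : 0 <= k%:R * l by rewrite mulr_ge0 // ltW.
have kT' : k%:R * l + l < T by rewrite -kE.
apply: le_trans (IH _); last by apply: lt_trans kT'; rewrite ltrDl.
have := euler_step _ _ (k%:R * l + l) (implicit_euler_dom p k dp) kl0 kT'.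
rewrite lerDl (ltW l0) lexx => /(_ isT).
rewrite [k%:R * l + l - _]addrAC subrr add0r scalerA mulfV ?gt_eqF // scale1r.
rewrite [implicit_euler E l p k + _]addrC subrK kE.
rewrite -[implicit_euler E l p k.+1]/(resolvent E l (implicit_euler E l p k)).
by lra.
Qed.

Lemma implicit_euler_error p k t : dom E p -> k%:R * l + l < T ->
  k%:R * l <= t <= k%:R * l + l ->
  `|u t - implicit_euler E l p k| ^+ 2 <= 3 * (`|u0 - p| ^+ 2 + 2 * l * fine (E p)).
Proof.
move=> dp kT tk; have /andP[kt tkl] := tk.
have kl0 : 0 <= k%:R * l by rewrite mulr_ge0 // ltW.
set pk := implicit_euler E l p k.
have dk : dom E pk by exact: implicit_euler_dom.
have := implicit_euler_error_nodes p k dp.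
rewrite -/pk (lt_trans _ kT) ?ltrDl // => /(_ isT) node.
have step := euler_step pk _ _ dk kl0 kT tk.
have [_ decay] := resolvent_decay pk dk.
set j := resolvent E l pk in step decay.
set a := k%:R * l in step node kt tkl.
set d := (t - a) *: (l^-1 *: (j - pk)) in step.
have d_le : `|d| ^+ 2 <= `|pk - j| ^+ 2.
  rewrite /d scalerA normrZ distrC exprMn ler_piMl ?sqr_ge0 //.
  rewrite expr_le1 // ger0_norm; last by rewrite divr_ge0 ?subr_ge0 // ltW.
  by rewrite ler_pdivrMr // mul1r lerBlDl.
have decay' : `|pk - j| ^+ 2 <= l * (fine (E pk) - fine (E j)).
  by rewrite -ler_pdivrMl // lerBrDl.
have Ej := fine_energy_ge0 j.
have tal : 2 * (fine (E pk) - fine (E j)) * (t - a) <= 2 * l * fine (E pk).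
  have : 0 <= fine (E pk) - fine (E j).
    by rewrite -(pmulr_rge0 _ l0); apply: le_trans decay'; exact: sqr_ge0.
  have : 0 <= t - a by rewrite subr_ge0.
  have : t - a <= l by rewrite lerBlDl.
  by have := fine_energy_ge0 pk; nra.
have le_sum : `|u t - pk| ^+ 2 <= 2 * `|u t - (pk + d)| ^+ 2 + 2 * `|d| ^+ 2.
  have -> : u t - pk = (u t - (pk + d)) + d by rewrite opprD addrA subrK.
  move: (u t - (pk + d)) => z; rewrite normD2.
  by have := sqr_ge0 `|z - d|; rewrite normB2; lra.
have El : l * (fine (E pk) - fine (E j)) <= l * fine (E pk).
  by rewrite ler_pM2l // gerBl.
have := sqr_ge0 `|u a - pk|.
have := sqr_ge0 `|u0 - p|.
lra.
Qed.

End error.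
End euler_scheme.

(** * Uniform convergence of the flows *)

Section convergence_of_flows.
Context {R : realType}.

Lemma uniform_cvg_norm {V : normedModType R} {I : Type} (F : set_system I) {FF : Filter F}
    (A : set R) (f : I -> R -> V) (g : R -> V) :
  (forall e, 0 < e -> \forall i \near F, forall t, A t -> `|g t - f i t| < e) ->
  {uniform A, f @ F --> g}.
Proof.
move=> H Q /uniform_nbhs[B [entB sub]].
move: entB; rewrite -entourage_ballE => -[e /= e0 eB].
apply: filterS (H e e0) => i Hi; apply: sub => t At; apply: eB => /=.
by rewrite -ball_normE /=; exact: Hi.
Qed.

Lemma exists_mesh_cell (l t : R) (n : nat) : 0 < l -> 0 <= t <= n.+1%:R * l ->
  exists2 k, (k <= n)%N & k%:R * l <= t <= k%:R * l + l.
Proof.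
move=> l0 /andP[t0 tn].
have [m ml mt] : exists2 m : nat, (m <= n.+1)%N & t <= m%:R * l by exists n.+1.
elim: m ml mt => [|m IH] mn tm.
  by exists 0%N => //; move: tm; rewrite mul0r add0r t0 => /le_trans -> //; exact: ltW.
have [tm'|tm'] := leP t (m%:R * l); first exact: IH (ltnW mn) tm'.
by exists m => //; rewrite ltW //= -{2}[l]mul1r -mulrDl natr1.
Qed.

Context {X0 : hilbertType R} {X : R -> hilbertType R}.
Variable L : forall eps : R, {linear X eps -> X0}.
Hypothesis L_mosco : (limf_esup (fun eps => opnorm (L eps)) 0^'+ <= 1)%E.
Context (E : forall eps : R, X eps -> \bar R) (E0 : X0 -> \bar R).
Hypothesis E_cl : forall eps, 0 < eps -> convex_lsc (E eps).
Hypothesis E0_cl : convex_lsc E0.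
Hypothesis E_mosco : mosco_functionals L E E0.

(** Strong convergence passes through one resolvent at a time. *)
Lemma implicit_euler_strong_cvg (l : R) (z : forall eps, X eps) (p : X0) k :
  0 < l -> dom E0 p -> (\forall e \near 0^'+, dom (E e) (z e)) -> strong_cvg L z p ->
  strong_cvg L (fun e => implicit_euler (E e) l (z e) k) (implicit_euler E0 l p k).
Proof.
move=> l0 dp dz zp; elim: k => [//|k IH].
have E_ge0 eps : 0 < eps -> forall v, (0 <= E eps v)%E by move=> /E_cl[].
have E0_ge0 v : (0 <= E0 v)%E by have [] := E0_cl.
apply: (resolvent_strong_cvg L L_mosco E E0 E_ge0 E0_ge0 E_mosco l _ _ _ _ l0 IH).
  near=> e; apply: resolventP => //.
    by apply: E_cl; near: e; exact: nbhs_right_gt.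
  by exists (z e); near: e.
by apply: resolventP => //; exists p.
Unshelve. all: by end_near. Qed.

Context (S : forall eps, X eps -> R -> X eps) (S0 : X0 -> R -> X0).
Hypothesis S_flow : forall eps, 0 < eps -> gradient_flow (E eps) (S eps).
Hypothesis S0_flow : gradient_flow E0 S0.

(** [p] is an element of the domain close to [u0], and the mesh [l] is small compared
    with its energy. Then the flow of [E0] and, for small parameters, those of [E e]
    stay close to Euler schemes with the common mesh [l], whose finitely many
    iterates on [[0, T]] converge strongly. *)
Lemma flows_uniform_cvg : uniform_cvg_flows L E E0 S S0.
Proof.
move=> T T0 u u0 cl0 cl us.
suff main r : 0 < r -> \forall e \near 0^'+, forall t, `[0, T]%classic t ->
    exists (p : X e) (p0 : X0), [/\ `|S e (u e) t - p| <= r, `|S0 u0 t - p0| <= r,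
      `|p0 - L e p| <= r & `| `|p0| - `|p| | <= r].
  split; apply: uniform_cvg_norm => d d0.
    have r0 : 0 < d / 5 by rewrite divr_gt0.
    have [a [a1 acvg aL]] := mosco_bound L L_mosco.
    have a2 : \forall e \near 0^'+, a e < 2 by apply: (cvgr_lt 1) => //; rewrite ltr1n.
    apply: filterS3 aL a2 (main _ r0) => e Le ae H t /H[p [p0 [h1 h2 h3 _]]].
    have -> : S0 u0 t - L e (S e (u e) t) =
        (S0 u0 t - p0) + (p0 - L e p) - L e (S e (u e) t - p).
      by rewrite linearB opprB !subrKA.
    apply: (le_lt_trans (ler_normB _ _)).
    have h4 := ler_normD (S0 u0 t - p0) (p0 - L e p).
    have h5 : `|L e (S e (u e) t - p)| <= 2 * (d / 5).
      by apply: (le_trans (Le _)); apply: ler_pM => //; [exact: le_trans ler01 (a1 _)|exact: ltW].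
    by lra.
  have r0 : 0 < d / 4 by rewrite divr_gt0.
  apply: filterS (main _ r0) => e H t /H[p [p0 [h1 h2 _ h3]]].
  have h4 := ler_dist_dist (S0 u0 t) p0.
  have h5 := ler_dist_dist (S e (u e) t) p.
  have -> : `|S0 u0 t| - `|S e (u e) t| =
    (`|S0 u0 t| - `|p0|) + (`|p0| - `|p|) - (`|S e (u e) t| - `|p|) by ring.
  apply: (le_lt_trans (ler_normB _ _)).
  have h6 := ler_normD (`|S0 u0 t| - `|p0|) (`|p0| - `|p|).
  by lra.
move=> r0.
have E_ge0 eps : 0 < eps -> forall v, (0 <= E eps v)%E by move=> /E_cl[].
(* the error bound [3 * (`|u0 - p| ^+ 2 + 2 * l * E0 p)] must be below [r ^+ 2] *)
pose d := r ^+ 2 / 9.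
have d0 : 0 < d by rewrite divr_gt0 // exprn_gt0.
have [p [dp pu]] : exists p, dom E0 p /\ `|u0 - p| ^+ 2 < d.
  have sd0 : 0 < Num.sqrt d by rewrite sqrtr_gt0.
  have [p [dp]] := cl0 (ball u0 (Num.sqrt d)) (nbhsx_ballx _ _ sd0).
  rewrite -ball_normE /= => pb; exists p; split=> //.
  by rewrite -[ltRHS]sqr_sqrtr ?(ltW d0) // ltr_sqr ?nnegrE // ltW.
have [_ /(_ _ dp)[z [zs Ez]]] := E_mosco.
pose c := fine (E0 p).
have c0 : 0 <= c by have [h _ _] := E0_cl; rewrite fine_ge0.
have E0c : E0 p = c%:E by have [h _ _] := E0_cl; rewrite fineK // dom_fin_num.
have [n nd] : exists n : nat, n.+1%:R^-1 < d / (2 * T * (c + 1)).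
  have h : 0 < d / (2 * T * (c + 1)) by rewrite divr_gt0 // !mulr_gt0 // ltr_wpDl.
  have [n _ H] := near_infty_natSinv_lt (PosNum h).
  by exists n; apply: H => /=.
pose l := T / n.+1%:R.
have l0 : 0 < l by rewrite divr_gt0.
have Tl : n.+1%:R * l = T by rewrite /l mulrC mulfVK // pnatr_eq0.
have lc : 2 * l * c < d.
  have : 2 * l * (c + 1) < d.
    move: nd; rewrite ltr_pdivlMr; last by rewrite !mulr_gt0 // ltr_wpDl.
    by rewrite /l; congr (_ < _); ring.
  by move: l0; nra.
have [dz pz] : (\forall e \near 0^'+, dom (E e) (z e)) /\
    fine (E e (z e)) @[e --> 0^'+] --> c.
  move: Ez; rewrite E0c => /fine_cvgP[fz cz]; split=> //.
  by apply: filterS fz => e; rewrite fin_numE => /andP[_]; rewrite -ltey.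
have err : \forall e \near 0^'+,
    `|u e - z e| ^+ 2 + 2 * l * fine (E e (z e)) < 3 * d.
  have [nuz _] := strong_cvgB L L_mosco _ _ _ _ us zs.
  apply: (cvgr_lt (`|u0 - p| ^+ 2 + 2 * l * c)); last by lra.
  by apply: cvgD; [rewrite !expr2; exact: cvgM|apply: cvgMr].
pose P k e := implicit_euler (E e) l (z e) k.
pose P0 k := implicit_euler E0 l p k.
have Ps k : strong_cvg L (P k) (P0 k) by exact: implicit_euler_strong_cvg.
have Pnear : \forall e \near 0^'+, forall k : 'I_n.+1,
    `|P0 k - L e (P k e)| <= r /\ `| `|P0 k| - `|P k e| | <= r.
  apply: filter_forall => k; have [h1 h2] := Ps k.
  by apply: filterI; [move/cvgrPdist_le : h2|move/cvgrPdist_le : h1]; exact.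
(* the error bound requires the last mesh interval to end before the final time *)
have T1 : 0 < T + 1 by rewrite addr_gt0.
near=> e => t; rewrite /= in_itv /= => tT.
have e0 : 0 < e by near: e; exact: nbhs_right_gt.
have [|k kn tk] := exists_mesh_cell l t n l0; first by rewrite Tl.
have kT : k%:R * l + l < T + 1.
  rewrite -{2}[l]mul1r -mulrDl natr1; apply: (@le_lt_trans _ _ T); last by rewrite ltrDl.
  by rewrite -Tl ler_pM2r // ler_nat.
have [PL Pn] : `|P0 k - L e (P k e)| <= r /\ `| `|P0 k| - `|P k e| | <= r.
  have H : forall k : 'I_n.+1,
    `|P0 k - L e (P k e)| <= r /\ `| `|P0 k| - `|P k e| | <= r by near: e.
  exact: (H (Ordinal (kn : (k < n.+1)%N))).
have r2 : 9 * d = r ^+ 2 by rewrite /d mulrC mulfVK // pnatr_eq0.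
exists (P k e), (P0 k); split=> //.
  rewrite -ler_sqr ?nnegrE ?(ltW r0) //.
  have dze : dom (E e) (z e) by near: e.
  apply: (le_trans (implicit_euler_error _ _ _ _ _ (E_cl e e0) l0
    (S_flow e e0 _ (cl e e0) _ T1) _ _ _ dze kT tk)).
  have h : `|u e - z e| ^+ 2 + 2 * l * fine (E e (z e)) < 3 * d by near: e.
  by lra.
rewrite -ler_sqr ?nnegrE ?(ltW r0) //.
apply: (le_trans (implicit_euler_error _ _ _ _ _ E0_cl l0
    (S0_flow _ cl0 _ T1) _ _ _ dp kT tk)).
by rewrite -/c; lra.
Unshelve. all: by end_near. Qed.

End convergence_of_flows.

Theorem theorem2p9 (R : realType) (X0 : hilbertType R) (X : R -> hilbertType R)
    (L : forall eps : R, {linear X eps -> X0})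
    (E : forall eps : R, X eps -> \bar R) (E0 : X0 -> \bar R)
    (S : forall eps : R, X eps -> R -> X eps) (S0 : X0 -> R -> X0)
    (L_bounded : forall eps : R, 0 < eps ->
       bounded_near (L eps) (nbhs (0 : X eps)))
    (X_mosco : mosco_spaces L)
    (E_convex_lsc : forall eps : R, 0 < eps -> convex_lsc (E eps))
    (E0_convex_lsc : convex_lsc E0)
    (S_flow : forall eps : R, 0 < eps -> gradient_flow (E eps) (S eps))
    (S0_flow : gradient_flow E0 S0)
    (E_mosco : mosco_functionals L E E0) :
  uniform_cvg_flows L E E0 S S0.
Proof.
have [L_mosco _] := X_mosco.
exact: (flows_uniform_cvg L L_mosco E E0 E_convex_lsc E0_convex_lsc E_mosco
  S S0 S_flow S0_flow).
Qed.
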